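(* Let $n\ge2$, let $\omega$ be a majorant, $\nu\in[2,+\infty)$, $\alpha>0$, $\beta\le\alpha$. Let $u\in\mathcal{C}^2(\mathbb{B}^n)$ be real-valued and satisfy $$|\Delta u(x)|\le a_1(x)|\nabla u(x)|^{b_1}+a_2(x)|u(x)|^{b_2}+a_3(x),\qquad x\in\mathbb{B}^n,$$ where $a_1,a_2,a_3$ are real-valued nonnegative continuous functions in $\mathbb{B}^n$ with $A_1:=\sup_{\mathbb{B}^n}a_1<+\infty$, $A_2:=\sup_{\mathbb{B}^n}a_2<\frac{2n}{\nu}$, $A_3:=\sup_{\mathbb{B}^n}a_3<+\infty$, and $b_1,b_2\in[0,1]$. Suppose also that $u\Delta u\ge0$ in $\mathbb{B}^n$ and $$\|u\|:=|u(0)|+\sup_{x\in\mathbb{B}^n}\left\{M_\nu(|\nabla u|,|x|)\,\omega\big(\phi(|x|)\big)\right\}<+\infty .$$ If $n\ge3$, then for all $r\in[0,1)$, $$\begin{aligned}M_\nu(u,r)\le\Bigg[&|u(0)|^2+\frac{\nu(\nu-1)}{(n-2)\omega^2(1)}\|u\|^2r^2\int_0^1\frac{t(1-t^{n-2})}{\phi^2(rt)}\,dt\\&+\frac{\nu A_1}{(n-2)\omega^{b_1}(1)}\|u\|^{b_1}r^2M_\nu(u,r)\int_0^1\frac{t(1-t^{n-2})}{\phi^{b_1}(rt)}\,dt\\&+\frac{\nu A_2}{2n}r^2M_\nu^{1+b_2}(u,r)+\frac{\nu A_3}{2n}r^2M_\nu(u,r)\Bigg]^{1/2}.\end{aligned}$$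 If $n=2$, then for all $r\in[0,1)$, $$\begin{aligned}M_\nu(u,r)\le\Bigg[&|u(0)|^2+\frac{\nu(\nu-1)}{\omega^2(1)}\|u\|^2r^2\int_0^1\frac{t\log\frac1t}{\phi^2(rt)}\,dt\\&+\frac{\nu A_1}{\omega^{b_1}(1)}\|u\|^{b_1}r^2M_\nu(u,r)\int_0^1\frac{t\log\frac1t}{\phi^{b_1}(rt)}\,dt\\&+\frac{\nu A_2}{4}r^2M_\nu^{1+b_2}(u,r)+\frac{\nu A_3}{4}r^2M_\nu(u,r)\Bigg]^{1/2}.\end{aligned}$$
   Context: $\mathbb{B}^n$ is the open unit ball of $\mathbb{R}^n$. A majorant is a continuous increasing function $\omega:[0,+\infty)\to[0,+\infty)$ with $\omega(0)=0$ such that $\omega(t)/t$ is non-increasing for $t>0$. For $s\in[0,1)$, $$\phi(s)=(1-s)^{\alpha}\big(1-\log(1-s)\big)^{\beta}.$$ For a function $f$ on $\mathbb{B}^n$, $\nu\in(0,+\infty)$ and $r\in[0,1)$, $$M_\nu(f,r)=\left(\int_{\partial\mathbb{B}^n}|f(r\zeta)|^\nu\,d\sigma(\zeta)\right)^{1/\nu},$$ where $d\sigma$ is the normalized surface measure on $\partial\mathbb{B}^n$. Powers such as $\omega^{2}(1)$, $\phi^{b_1}(rt)$, $M_\nu^{1+b_2}(u,r)$ mean $(\omega(1))^2$, $(\phi(rt))^{b_1}$, $(M_\nu(u,r))^{1+b_2}$. Zeroth powers are taken to be $1$. *)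

(* Defs.v *)
From HB Require Import structures.
From mathcomp Require Import all_boot all_order all_algebra.
From mathcomp Require Import all_classical all_reals all_analysis.
From mathcomp Require Import measurable_realfun.
Set Implicit Arguments.
Unset Strict Implicit.
Unset Printing Implicit Defensive.
Import Order.TTheory GRing.Theory Num.Theory.
Import numFieldNormedType.Exports.
Local Open Scope classical_set_scope.
Local Open Scope ring_scope.

Definition measure_rV_display : measure_display -> measure_display.
Proof. exact. Qed.

Section measurable_rV.
Context {d} {T : measurableType d}.
Variable n : nat.

Let coord : 'I_n -> 'rV[T]_n -> T := fun i x => x ord0 i.

Let rV_set0 : g_sigma_preimage coord set0.
Proof. exact: sigma_algebra0. Qed.

Let rV_setC A : g_sigma_preimage coord A -> g_sigma_preimage coord (~` A).
Proof. exact: sigma_algebraC. Qed.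

Let rV_bigcup (F : _^nat) : (forall i, g_sigma_preimage coord (F i)) ->
  g_sigma_preimage coord (\bigcup_i (F i)).
Proof. exact: sigma_algebra_bigcup. Qed.

(* The product sigma-algebra; for T = R it is the Borel sigma-algebra. *)
HB.instance Definition _ := @isMeasurable.Build (measure_rV_display d)
  'rV[T]_n (g_sigma_preimage coord) rV_set0 rV_setC rV_bigcup.

Lemma measurable_coord (i : 'I_n) : measurable_fun [set: 'rV[T]_n] (coord i).
Proof.
move=> _ Y mY; rewrite setTI; apply: sub_sigma_algebra => /=.
rewrite -bigcup_seq/=; exists i => /=; first by rewrite mem_index_enum.
by exists Y => //; rewrite setTI.
Qed.

Lemma measurable_fun_rVP d' (S : measurableType d') (f : S -> 'rV[T]_n) :
  (forall i, measurable_fun [set: S] (fun x => f x ord0 i)) ->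
  measurable_fun [set: S] f.
Proof.
move=> mf _ A mA; rewrite setTI.
pose G : set (set 'rV[T]_n) := [set A | measurable (f @^-1` A)].
suff : (g_sigma_preimage coord) `<=` G by apply.
apply: smallest_sub.
- split; rewrite /G /=.
  + by rewrite preimage_set0.
  + by move=> B mB; rewrite setTD preimage_setC; exact: measurableC.
  + by move=> F mF; rewrite preimage_bigcup; exact: bigcupT_measurable.
- rewrite -bigcup_seq => B [i _ [C mC <-]]; rewrite /G /= setTI.
  by have := mf i measurableT C mC; rewrite setTI.
Qed.

End measurable_rV.

Section lebesgue_rV.
Context {R : realType}.

Let consV n (p : R * 'rV[R]_n) : 'rV[R]_(1 + n) := row_mx (const_mx p.1) p.2.

Fixpoint lebesgue_rV (n : nat) : set 'rV[R]_n -> \bar R :=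
  match n with
  | 0 => \d_(0 : 'rV[R]_0)
  | m.+1 => pushforward (lebesgue_measure \x @lebesgue_rV m)%E
              (fun p => row_mx (const_mx p.1) p.2 : 'rV[R]_(1 + m))
  end.

Let measurable_consV n : measurable_fun setT (@consV n).
Proof.
apply: measurable_fun_rVP => i.
case: (split_ordP i) => j ->.
- have -> : (fun p => @consV n p ord0 (lshift n j)) = fst.
    by apply/funext => p; rewrite /consV row_mxEl mxE.
  exact: (@measurable_fst _ _ R (matrix R 1 n)).
- have -> : (fun p => @consV n p ord0 (rshift 1 j)) =
            (fun x : 'rV[R]_n => x ord0 j) \o snd.
    by apply/funext => p; rewrite /consV row_mxEr.
  by apply: measurableT_comp => //; exact: measurable_coord.
Qed.

Let unconsV n (x : 'rV[R]_(1 + n)) : R * 'rV[R]_n :=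
  (x ord0 ord0, rsubmx x).

Let unconsVK n : cancel (@consV n) (@unconsV n).
Proof.
move=> [t v]; rewrite /consV /unconsV /= row_mxKr; congr pair.
have -> : ord0 = lshift n ord0 :> 'I_(1 + n) by exact: val_inj.
by rewrite row_mxEl mxE.
Qed.

Let consVK n : cancel (@unconsV n) (@consV n).
Proof.
move=> x; rewrite /consV /unconsV /= -[RHS]hsubmxK; congr row_mx.
apply/rowP => i; rewrite !mxE (ord1 i); congr (x _ _).
exact: val_inj.
Qed.

Let measurable_unconsV n : measurable_fun setT (@unconsV n).
Proof.
apply: measurable_fun_pair; first exact: measurable_coord.
apply: measurable_fun_rVP => i.
have -> : (fun x : 'rV[R]_(1 + n) => (@unconsV n x).2 ord0 i) =
          (fun x => x ord0 (rshift 1 i)) by apply/funext => x; rewrite mxE.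
exact: measurable_coord.
Qed.

Let lebesgue_rV_measure n :
  {mu : {sigma_finite_measure set 'rV[R]_n -> \bar R} | @lebesgue_rV n = mu}.
Proof.
elim: n => [|n [mu mE]] /=.
  by exists (\d_(0 : 'rV[R]_0) : {sigma_finite_measure set _ -> \bar R}).
rewrite mE.
pose P : {measure set (measurableTypeR R * 'rV[R]_n)%type -> \bar R} :=
  (lebesgue_measure \x mu)%E.
pose nu : {measure set 'rV[R]_n.+1 -> \bar R} :=
  measure_function_pushforward__canonical__measure_function_Measure
    P (@measurable_consV n).
have sf : sigma_finite setT nu.
  have /sigma_finiteP[F [FT ndF Foo]] := sigma_finiteT (@lebesgue_measure R).
  have /sigma_finiteP[G [GT ndG Goo]] := sigma_finiteT mu.
  exists (fun i => @unconsV n @^-1` (F i `*` G i)).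
    rewrite -preimage_bigcup -(@preimage_setT _ _ (@unconsV n)); congr preimage.
    rewrite -setXTT FT GT predeqE => -[x y]; split.
      move=> [/= [i _ Fix] [j _ Gjy]]; exists (maxn i j) => //; split.
      - by move: x Fix; exact/subsetPset/ndF/leq_maxl.
      - by move: y Gjy; exact/subsetPset/ndG/leq_maxr.
    by move=> [i _ []/= ? ?]; split; exists i.
  move=> i; have [mFi Fi] := Foo i; have [mGi Gi] := Goo i.
  split.
    rewrite -[X in measurable X]setTI.
    by apply: measurable_unconsV => //; exact: measurableX.
  rewrite /nu /= /pushforward -comp_preimage.
  rewrite (_ : _ \o _ = id) ?preimage_id; last first.
    by apply/funext => p; exact: unconsVK.
  by rewrite product_measure1E// lte_mul_pinfty// ge0_fin_numE.
pose H := Measure_isSigmaFinite.Build _ _ _ nu sf.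
pose nu' : {sigma_finite_measure set 'rV[R]_n.+1 -> \bar R} :=
  HB.pack (nu : set _ -> \bar R) (Measure.on nu) H.
by exists nu'.
Qed.


Let lebesgue_rV0 n : @lebesgue_rV n set0 = 0%E.
Proof. by have [mu ->] := lebesgue_rV_measure n; exact: measure0. Qed.

Let lebesgue_rV_ge0 n A : (0 <= @lebesgue_rV n A)%E.
Proof. by have [mu ->] := lebesgue_rV_measure n; exact: measure_ge0. Qed.

Let lebesgue_rV_sigma_additive n : semi_sigma_additive (@lebesgue_rV n).
Proof.
by have [mu ->] := lebesgue_rV_measure n; exact: measure_semi_sigma_additive.
Qed.

HB.instance Definition _ n := isMeasure.Build _ _ _ (@lebesgue_rV n)
  (lebesgue_rV0 n) (@lebesgue_rV_ge0 n) (@lebesgue_rV_sigma_additive n).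

Let sigmaT_finite_lebesgue_rV n : sigma_finite setT (@lebesgue_rV n).
Proof. by have [mu ->] := lebesgue_rV_measure n; exact: sigma_finiteT. Qed.

HB.instance Definition _ n := Measure_isSigmaFinite.Build _ _ _
  (@lebesgue_rV n) (@sigmaT_finite_lebesgue_rV n).

Lemma measurable_box n (a b : R) :
  measurable [set x : 'rV[R]_n | forall i, a <= x ord0 i <= b].
Proof.
rewrite (_ : mkset _ = \bigcap_i (fun x : 'rV[R]_n => x ord0 i) @^-1` `[a, b]).
  apply: fin_bigcap_measurable => // i _.
  by rewrite -[X in measurable X]setTI; exact: measurable_coord.
apply/seteqP; split=> x /= h i.
  by rewrite ?in_itv/= => _; exact: h.
by have := h i I; rewrite /= in_itv.
Qed.

Lemma lebesgue_rV_box n (a b : R) : a <= b ->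
  @lebesgue_rV n [set x | forall i, a <= x ord0 i <= b] = ((b - a) ^+ n)%:E.
Proof.
move=> ab; elim: n => [|n IH].
  by rewrite /= diracE mem_set ?expr0// => -[].
rewrite /= /pushforward.
rewrite (_ : _ @^-1` _ = `[a, b]%classic `*`
  [set x : 'rV[R]_n | forall i, a <= x ord0 i <= b]).
  rewrite product_measure1E//=; last exact: measurable_box.
  rewrite [X in (_ * X)%E]IH lebesgue_measure_itv/= lte_fin.
  have [ab'|ba] := ltP a b; first by rewrite -EFinD -EFinM exprS.
  have -> : a = b by apply/eqP; rewrite eq_le ab.
  by rewrite subrr exprS mul0r mul0e.
pose w (t : R) v : 'rV[R]_(1 + n) := row_mx (const_mx t) v.
have wE t v : (forall i : 'I_(1 + n), a <= w t v ord0 i <= b) <->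
    a <= t <= b /\ (forall i, a <= v ord0 i <= b).
  split=> [h|[ht hv] i].
    split; first by have := h (lshift n (ord0 : 'I_1)); rewrite row_mxEl mxE.
    by move=> i; have := h (rshift 1 i); rewrite row_mxEr.
  by case: (split_ordP i) => j ->; rewrite ?row_mxEl ?row_mxEr ?mxE.
by apply/seteqP; split=> -[t v] /=; rewrite in_itv/= => /wE.
Qed.

End lebesgue_rV.

Section euclidean.
Context {R : realType} {n : nat}.
Implicit Types x : 'rV[R]_n.

(* The library norm on row vectors is the sup norm. *)
Definition enorm x : R := Num.sqrt (\sum_i x ord0 i ^+ 2).

Definition unit_ball : set 'rV[R]_n := [set x | enorm x < 1].

Definition unit_sphere : set 'rV[R]_n := [set x | enorm x = 1].

Definition sphere_cone (A : set 'rV[R]_n) : set 'rV[R]_n :=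
  [set x | 0 < enorm x < 1 /\ A ((enorm x)^-1 *: x)].

(* Surface measure defined by polar coordinates: n times the volume of the cone
   over A, so that lebesgue_rV disintegrates as r^(n-1) dr times surface_measure.
   sphere_measure is its normalization (total mass 1, see below for 0 < n).
   Both measures below are carried by unit_sphere. *)
Definition surface_measure (A : set 'rV[R]_n) : \bar R :=
  (n%:R%:E * lebesgue_rV (sphere_cone A))%E.

Definition sphere_measure (A : set 'rV[R]_n) : \bar R :=
  (surface_measure A * (fine (surface_measure unit_sphere))^-1%:E)%E.

Lemma enorm_ge0 x : 0 <= enorm x. Proof. exact: sqrtr_ge0. Qed.

Lemma enormZ (t : R) x : enorm (t *: x) = `|t| * enorm x.
Proof.
rewrite /enorm -sqrtr_sqr -sqrtrM ?sqr_ge0// mulr_sumr; congr Num.sqrt.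
by apply: eq_bigr => i _; rewrite mxE exprMn.
Qed.

Lemma measurable_enorm : measurable_fun setT enorm.
Proof.
apply: measurableT_comp.
  by apply: continuous_measurable_fun; exact: sqrt_continuous.
by apply: measurable_sum => i; apply: measurable_funX; exact: measurable_coord.
Qed.

Let proj x := (enorm x)^-1 *: x.

Let measurable_proj : measurable_fun setT proj.
Proof.
apply: measurable_fun_rVP => i.
have -> : (fun x => proj x ord0 i) = (fun x => enorm x `^ (-1) * x ord0 i).
  by apply/funext => x; rewrite mxE powR_inv1// enorm_ge0.
apply: measurable_funM; last exact: measurable_coord.
apply: (@measurableT_comp _ _ _ _ _ _ (@powR R ^~ (-1))) measurable_enorm.
exact: measurable_powR.
Qed.

Let D : set 'rV[R]_n := [set x | 0 < enorm x < 1].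

Let mD : measurable D.
Proof.
rewrite (_ : D = enorm @^-1` `]0, 1[).
  by rewrite -[X in measurable X]setTI; exact: measurable_enorm.
by apply/seteqP; split => x; rewrite /D /= in_itv.
Qed.

Let sphere_coneE A : sphere_cone A = (proj @^-1` A) `&` D.
Proof. by apply/seteqP; split => x [? ?]; split. Qed.

Let surface_measureE : {mu : {measure set 'rV[R]_n -> \bar R} |
  surface_measure = mu}.
Proof.
pose nu : {measure set 'rV[R]_n -> \bar R} := mrestr (@lebesgue_rV R n) mD.
pose mu : {measure set 'rV[R]_n -> \bar R} :=
  measure_function_pushforward__canonical__measure_function_Measure
    nu measurable_proj.
exists (mscale (NngNum (ler0n R n)) mu : {measure set _ -> \bar R}).
apply/funext => A.
by rewrite /surface_measure sphere_coneE.
Qed.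

Let surface_measure0 : surface_measure set0 = 0%E.
Proof. by have [mu ->] := surface_measureE; exact: measure0. Qed.

Let surface_measure_ge0 A : (0 <= surface_measure A)%E.
Proof. by have [mu ->] := surface_measureE; exact: measure_ge0. Qed.

Let surface_measure_sigma_additive : semi_sigma_additive surface_measure.
Proof.
by have [mu ->] := surface_measureE; exact: measure_semi_sigma_additive.
Qed.

HB.instance Definition _ := isMeasure.Build _ _ _ surface_measure
  surface_measure0 surface_measure_ge0 surface_measure_sigma_additive.

Let c_ge0 : 0 <= (fine (surface_measure unit_sphere))^-1.
Proof. by rewrite invr_ge0 fine_ge0. Qed.

Let sphere_measureE :
  sphere_measure = mscale (NngNum c_ge0) surface_measure.
Proof. by apply/funext => A; rewrite /sphere_measure muleC. Qed.

Let sphere_measure0 : sphere_measure set0 = 0%E.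
Proof. by rewrite sphere_measureE; exact: measure0. Qed.

Let sphere_measure_ge0 A : (0 <= sphere_measure A)%E.
Proof. by rewrite sphere_measureE; exact: measure_ge0. Qed.

Let sphere_measure_sigma_additive : semi_sigma_additive sphere_measure.
Proof. by rewrite sphere_measureE; exact: measure_semi_sigma_additive. Qed.

HB.instance Definition _ := isMeasure.Build _ _ _ sphere_measure
  sphere_measure0 sphere_measure_ge0 sphere_measure_sigma_additive.

Lemma sphere_measure_sphere : (0 < n)%N -> sphere_measure unit_sphere = 1%E.
Proof.
move=> n0.
have ltn1 : 0 < (n%:R + 1 : R)^-1 < 1.
  by rewrite invr_gt0 ltr_wpDl//= invf_lt1 ?ltrDr ?ltr0n// ltr_wpDl.
have coneS : sphere_cone unit_sphere = D.
  apply/seteqP; split => x /=; first by case.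
  move=> /[dup] Dx /andP[x0 _]; split => //.
  rewrite /unit_sphere /= enormZ ger0_norm ?invr_ge0 ?enorm_ge0//.
  by rewrite mulVf// gt_eqF.
set c := (n%:R + 1 : R)^-1 in ltn1; have /andP[c0 c1] := ltn1.
have Dfin : (lebesgue_rV D < +oo)%E.
  apply: (@le_lt_trans _ _ (lebesgue_rV
      [set x : 'rV[R]_n | forall i, -1 <= x ord0 i <= 1])); last first.
    by rewrite lebesgue_rV_box ?ltry.
  apply: le_measure; [exact: (mem_set mD)|exact: (mem_set (measurable_box _ _))|].
  move=> x /= /andP[_ x1] i; rewrite -ler_norml.
  rewrite -(@ler_pXn2r _ 2)// ?nnegrE// expr1n real_normK ?num_real//.
  have : enorm x ^+ 2 <= 1 by rewrite expr_le1// ?enorm_ge0// ltW.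
  rewrite sqr_sqrtr; last by apply: sumr_ge0 => j _; exact: sqr_ge0.
  apply: le_trans; rewrite (bigD1 i)//= lerDl.
  by apply: sumr_ge0 => j _; exact: sqr_ge0.
have Dgt : (0 < lebesgue_rV D)%E.
  apply: (@lt_le_trans _ _ (lebesgue_rV
      [set x : 'rV[R]_n | forall i, c / 2 <= x ord0 i <= c])).
    rewrite lebesgue_rV_box; last by rewrite ler_pdivrMr// ler_peMr ?ltW// ltr1n.
    rewrite lte_fin exprn_gt0// subr_gt0 ltr_pdivrMr// ltr_pMr// ltr1n//.
  apply: le_measure; [exact: (mem_set (measurable_box _ _))|exact: (mem_set mD)|].
  move=> x /= xi; rewrite /D /= /enorm.
  have s2 : \sum_i x ord0 i ^+ 2 <= \sum_(i < n) c ^+ 2.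
    apply: ler_sum => i _; have /andP[a b] := xi i.
    by rewrite ler_pXn2r ?nnegrE//; [rewrite (le_trans _ a)// divr_ge0// ltW|exact: ltW].
  have s1 : \sum_(i < n) (c / 2) ^+ 2 <= \sum_i x ord0 i ^+ 2.
    apply: ler_sum => i _; have /andP[a b] := xi i.
    by rewrite ler_pXn2r ?nnegrE// ?(le_trans _ a)// divr_ge0// ltW.
  rewrite sqrtr_gt0 (lt_le_trans _ s1)/=; last first.
    by rewrite sumr_const card_ord pmulrn_lgt0// exprn_gt0// divr_gt0.
  rewrite -sqrtr1 ltr_sqrt// (le_lt_trans s2)// sumr_const card_ord.
  rewrite -mulr_natl expr2 mulrA.
  have nc : n%:R * c < 1 by rewrite ltr_pdivrMr ?ltr_wpDl// mul1r ltrDl.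
  by rewrite (lt_trans _ c1)// gtr_pMl.
rewrite /sphere_measure.
have sfin : surface_measure unit_sphere \is a fin_num.
  rewrite /surface_measure coneS ge0_fin_numE; last first.
    by rewrite mule_ge0// lee_fin.
  by rewrite lte_mul_pinfty// lee_fin.
rewrite -[X in (X * _)%E](fineK sfin) -EFinM divff// fine_eq0//.
by rewrite /surface_measure coneS mule_neq0// ?gt_eqF// lte_fin ltr0n.
Qed.


(* M_nu(f, r) *)
Definition sphere_mean (nu : R) (f : 'rV[R]_n -> R) (r : R) : R :=
  (\int[sphere_measure]_(z in unit_sphere) `|f (r *: z)| `^ nu) `^ nu^-1.

Definition partial (i : 'I_n) (f : 'rV[R]_n -> R) : 'rV[R]_n -> R :=
  'D_(delta_mx ord0 i) f.

Definition gradient (f : 'rV[R]_n -> R) x : 'rV[R]_n := \row_i partial i f x.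

Definition laplacian (f : 'rV[R]_n -> R) x : R :=
  \sum_i partial i (partial i f) x.

Definition derivable_in (D : set 'rV[R]_n) (f : 'rV[R]_n -> R) : Prop :=
  forall x, D x -> forall i, derivable f x (delta_mx ord0 i).

(* Meaningful for open D: it then depends only on the restriction of f to D. *)
Definition C2_in (D : set 'rV[R]_n) (f : 'rV[R]_n -> R) : Prop :=
  [/\ {in D, continuous f}, derivable_in D f,
      forall i, {in D, continuous (partial i f)} /\ derivable_in D (partial i f) &
      forall i j, {in D, continuous (partial j (partial i f))}].

Definition sup_ball (f : 'rV[R]_n -> R) : R := sup (f @` unit_ball).

Definition bounded_above_ball (f : 'rV[R]_n -> R) : Prop :=
  has_ubound (f @` unit_ball).

End euclidean.

Section majorant.
Context {R : realType}.

(* "Increasing" is read in the weak sense. The clause 0 < omega 1 follows from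
   the strict sense; in the weak sense it only excludes omega = 0 on [0, +oo[,
   for which division by omega 1 is meaningless. *)
Definition majorant (omega : R -> R) : Prop :=
  [/\ {within `[0, +oo[, continuous omega},
      omega 0 = 0,
      {in `[0, +oo[ &, {homo omega : s t / s <= t}},
      {in `]0, +oo[ &, {homo (fun t => omega t / t) : s t /~ s <= t}} &
      0 < omega 1].

Definition phi (alpha beta s : R) : R :=
  (1 - s) `^ alpha * (1 - ln (1 - s)) `^ beta.

Definition weighted_grad n (omega : R -> R) (alpha beta nu : R)
    (u : 'rV[R]_n -> R) (x : 'rV[R]_n) : R :=
  sphere_mean nu (fun y => enorm (gradient u y)) (enorm x) *
  omega (phi alpha beta (enorm x)).

(* The quantity written ||u||. *)
Definition u_norm n (omega : R -> R) (alpha beta nu : R)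
    (u : 'rV[R]_n -> R) : R :=
  `|u 0| + sup_ball (weighted_grad omega alpha beta nu u).

End majorant.

(* Main.v *)
(** Let [F = |u|^nu], which is C^2, and let [g r] be its mean over the sphere of
    radius [r]. Lebesgue measure is invariant under shears (Fubini), hence under
    plane rotations, which are products of three shears, hence so is the sphere
    measure. Differentiating this invariance gives [int (z_i d_j h - z_j d_i h) = 0]
    on every sphere; taking [h y = y_i d_j F y] and summing over [i, j] yields
    [g'' + (n - 1) / r g' = mean of (Delta F)] without any divergence theorem.
    As [u Delta u >= 0], [Delta F >= 0], so [g] is nondecreasing; Hoelder's inequality
    and the growth hypotheses bound the mean of [Delta F] at radius [r t]. Integrating
    the equation against the Green kernel and dividing by [M_nu(u, r)^(nu - 2)] gives
    the estimate. *)

Require Import Defs.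
From mathcomp Require Import all_boot all_order all_algebra.
From mathcomp Require Import all_classical all_reals all_analysis.
From mathcomp Require Import measurable_realfun ring lra.
Import Order.TTheory GRing.Theory Num.Theory.
Import numFieldNormedType.Exports.
Local Open Scope classical_set_scope.
Local Open Scope ring_scope.
Set Implicit Arguments.
Unset Strict Implicit.
Unset Printing Implicit Defensive.

(** * Borel measurability and compact balls in row vectors *)

(** Three choices shape the proof. The radial equation is kept multiplied by $s^2$, so that it holds
    at the centre too, and a factor is cancelled only where the radius is positive. The mean of
    $\Delta F$ is never integrated over the radius: with [k] the kernel, $h(t)=g(rt)$ and [E] a
    primitive of an explicit continuous majorant, $kh'+h-E$ has nonpositive derivative on $]0,1[$,
    and the mean value theorem suffices. Finally, the kernel enters only through $k(0)=k(1)=0$,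
    $k\ge0$ and $k'=(n-1)k/t-c$, so one argument serves $n\ge3$ with $c=n-2$ and $n=2$ with $c=1$;
    the same equation yields $\int_0^1k=c/(2n)$, the source of the constants $2n$ and $4$. The
    condition $\nu\ge2$ makes $|t|^\nu$ twice continuously differentiable, hence [F] is $C^2$ across
    the zeros of [u]. The denominators $\omega(1)\phi$ come from $\phi\le1$ and the monotonicity of
    $\omega(t)/t$. *)

Section row_vector_measurability.
Context {R : realType} {n : nat}.

(** The sigma-algebra is generated by the coordinates, so open cubes are measurable; an open set is
    the countable union of the cubes with rational centre and radius $1/(k+1)$ that it contains. *)
Lemma open_measurable_rV (U : set 'rV[R]_n) : open U -> measurable U.
Proof.
move=> oU.
pose B (p : 'rV[rat]_n * nat) : set 'rV[R]_n :=
  [set y | forall i, `|y ord0 i - ratr (p.1 ord0 i)| < p.2.+1%:R^-1].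
have mB p : measurable (B p).
  rewrite (_ : B p = \bigcap_i (fun y : 'rV[R]_n => y ord0 i) @^-1`
      ball (ratr (p.1 ord0 i) : R) p.2.+1%:R^-1).
    apply: fin_bigcap_measurable => // i _.
    rewrite -[X in measurable X]setTI; apply: measurable_coord => //.
    exact: measurable_ball.
  apply/seteqP; split => y /= h i; first by move=> _; rewrite -ball_normE /= distrC; exact: h.
  by have := h i I; rewrite -ball_normE /= distrC.
rewrite (_ : U = \bigcup_(p in setT) (if pselect (B p `<=` U) then B p else set0)).
  apply: countable_bigcupT_measurable => // p.
  by case: (pselect (B p `<=` U)) => ?; [exact: mB|exact: measurable0].
apply/seteqP; split => [x Ux|x [p _]]; last by case: (pselect (B p `<=` U)) => [BU /BU|? []].
have : nbhs x U by exact: open_nbhs_nbhs.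
move=> /nbhs_ballP[e /= e0 eU].
(* Half of [e]: the cube is centred at a rational point near [x], not at [x], so its points may be
   at twice its radius from [x]. *)
have [k /=] := ltr_add_invr (divr_gt0 e0 (ltr0Sn R 1)); rewrite add0r => ke.
have qP i : {q : rat | `|x ord0 i - ratr q| < k.+1%:R^-1}.
  apply: cid.
  have h : x ord0 i < x ord0 i + k.+1%:R^-1 by rewrite ltrDl invr_gt0.
  have [q] := rat_in_itvoo h; rewrite in_itv/= => /andP[h1 h2].
  by exists q; rewrite distrC ger0_norm ?subr_ge0 ?ltrBlDl // ltW.
exists (\row_i sval (qP i), k) => //.
case: (pselect _) => [? i|].
  by rewrite mxE; have := svalP (qP i).
case => y By; apply: eU; split => // i j; rewrite (ord1 i).
have := By j; rewrite /= mxE; have /= := svalP (qP j).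
set q := ratr _ => h1 h2; rewrite -ball_normE /=.
rewrite (_ : _ - _ = (x ord0 j - q) - (y ord0 j - q)); last by ring.
rewrite (le_lt_trans (ler_normB _ _))// (lt_trans (ltrD h1 h2))//.
by rewrite [ltRHS]splitr ltrD.
Qed.

Lemma continuous_open_measurable_fun (D : set 'rV[R]_n) (f : 'rV[R]_n -> R) :
  open D -> {in D, continuous f} -> measurable_fun D f.
Proof.
move=> oD cf; apply: (measurability _ (RGenOpens.measurableE R)) => _ [_ [a [b ->] <-]].
apply: open_measurable_rV; rewrite openE => x [Dx fx].
have oab : open `]a, b[%classic by exact: interval_open.
rewrite /interior; apply: filterI; first exact: open_nbhs_nbhs.
by apply: cf; [rewrite inE|exact: open_nbhs_nbhs].
Qed.

End row_vector_measurability.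

Section enorm_theory.
Context {R : realType} {n : nat}.
Implicit Types x : 'rV[R]_n.

Lemma enorm_sqr x : enorm x ^+ 2 = \sum_i x ord0 i ^+ 2.
Proof. by rewrite sqr_sqrtr// sumr_ge0// => i _; exact: sqr_ge0. Qed.

Lemma coord_le_enorm x i : `|x ord0 i| <= enorm x.
Proof.
rewrite -(@ler_pXn2r _ 2)// ?nnegrE ?enorm_ge0// enorm_sqr real_normK ?num_real//.
by rewrite (bigD1 i)//= lerDl sumr_ge0// => j _; exact: sqr_ge0.
Qed.

Lemma enorm0 : enorm (0 : 'rV[R]_n) = 0.
Proof. by rewrite /enorm big1 ?sqrtr0// => i _; rewrite mxE expr0n. Qed.

Lemma continuous_coord (i : 'I_n) : continuous (fun x => x ord0 i).
Proof. by move=> x; exact: coord_continuous. Qed.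

Lemma continuous_sumr (T : topologicalType) (I : Type) (r : seq I) (P : pred I)
    (f : I -> T -> R) (t : T) : (forall i, P i -> {for t, continuous (f i)}) ->
  {for t, continuous (fun y => \sum_(i <- r | P i) f i y)}.
Proof.
move=> cf; elim: r => [|i r IH].
  rewrite (_ : (fun _ => _) = fun=> 0); first exact: cst_continuous.
  by apply/funext => y; rewrite big_nil.
rewrite (_ : (fun _ => _) = fun y => (if P i then f i y else 0) + \sum_(i <- r | P i) f i y); last first.
  by apply/funext => y; rewrite big_cons; case: ifP => // _; rewrite add0r.
apply: (@continuousD _ _ _ (fun y => if P i then f i y else 0)) => //.
by case: (boolP (P i)) => [/cf//|_]; exact: cst_continuous.
Qed.

Lemma continuous_enorm : continuous (@enorm R n).
Proof.
move=> x; apply: (@continuous_comp _ _ _ (fun x => \sum_i x ord0 i ^+ 2) Num.sqrt); last exact: sqrt_continuous.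
apply: continuous_sumr => i _.
apply: (@continuous_comp _ _ _ (fun x => x ord0 i) (fun t => t ^+ 2)); first exact: continuous_coord.
exact: exprn_continuous.
Qed.

Definition eball (c : R) : set 'rV[R]_n := [set x | enorm x < c].

Lemma open_eball c : open (eball c).
Proof.
rewrite (_ : eball c = enorm @^-1` `]-oo, c[%classic).
  by apply: open_comp => [x _|]; [exact: continuous_enorm|exact: interval_open].
by apply/seteqP; split => x; rewrite /= in_itv.
Qed.

Lemma compact_eball (c : R) : compact [set x : 'rV[R]_n | enorm x <= c].
Proof.
apply: bounded_closed_compact.
  exists c; split; first exact: num_real.
  move=> M cM x /= xc; rewrite [leLHS]/Num.norm /= mx_normrE; apply/bigmax_leP; split.
    by rewrite (le_trans _ (ltW cM))// (le_trans _ xc)// enorm_ge0.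
  by move=> [i j] _ /=; rewrite (ord1 i) (le_trans (coord_le_enorm _ _))// (le_trans xc)// ltW.
rewrite (_ : mkset _ = enorm @^-1` `]-oo, c]%classic).
  by apply: closed_comp => [x _|]; [exact: continuous_enorm|exact: interval_closed].
by apply/seteqP; split => x; rewrite /= in_itv.
Qed.

(** The gap between [c] and [d] places a compact ball inside the open set of continuity. This is the
    source of the constants that dominate derivatives under the integral sign. *)
Lemma bounded_eball (f : 'rV[R]_n -> R) c d : {in eball d, continuous f} -> c < d ->
  exists2 M, 0 <= M & forall x, enorm x <= c -> `|f x| <= M.
Proof.
move=> cf cd.
have sub : [set x : 'rV[R]_n | enorm x <= c] `<=` eball d by move=> x /= xc; exact: le_lt_trans cd.
have : compact (f @` [set x : 'rV[R]_n | enorm x <= c]).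
  apply: continuous_compact; last exact: compact_eball.
  apply: continuous_in_subspaceT => x /[!inE] xc; apply: cf; rewrite inE; exact: sub.
move=> /compact_bounded [M [_ hM]].
exists (`|M| + 1); first by rewrite addr_ge0.
move=> x xc; apply: hM; last by exists x.
by rewrite ltr_pwDr// ler_norm.
Qed.

End enorm_theory.

(** * Rotation invariance of the sphere measure *)

(** By uniqueness of Lebesgue measure: its image under a translation has the same value on half-open
    intervals. *)
Lemma lebesgue_measure_translate {R : realType} (a : R) (A : set R) :
  measurable A -> lebesgue_measure ((fun t => t + a) @^-1` A) = lebesgue_measure A.
Proof.
move=> mA.
have mT : measurable_fun setT (fun t : R => t + a).
  exact: measurable_funD.
rewrite -[LHS]/(pushforward lebesgue_measure ((fun t => t + a) : _ -> measurableTypeR R) A).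
apply/esym/lebesgue_measure_unique => //= _ [[u v]] _ <-.
rewrite /pushforward.
rewrite (_ : _ @^-1` _ = `]u - a, v - a]%classic); last first.
  by apply/seteqP; split => t /=; rewrite !in_itv/= ltrBlDr lerBrDr.
rewrite !lebesgue_measure_itv /= !lte_fin ltrD2r.
by case: ifPn => // _; rewrite -!EFinD; congr EFin; ring.
Qed.

Section consV.
Context {R : realType}.

Definition consV {n} (p : R * 'rV[R]_n) : 'rV[R]_(1 + n) := row_mx (const_mx p.1) p.2.

Lemma measurable_consV n : measurable_fun setT (@consV n).
Proof.
apply: measurable_fun_rVP => i; case: (split_ordP i) => j ->.
- rewrite (_ : (fun _ => _) = fst); first exact: measurable_fst.
  by apply/funext => p; rewrite /consV row_mxEl mxE.
- rewrite (_ : (fun _ => _) = (fun x : 'rV[R]_n => x ord0 j) \o snd).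
    by apply: measurableT_comp => //; exact: measurable_coord.
  by apply/funext => p; rewrite /consV row_mxEr.
Qed.

Lemma lebesgue_rVS n (A : set 'rV[R]_(1 + n)) :
  lebesgue_rV A = (lebesgue_measure \x @lebesgue_rV R n)%E (consV @^-1` A).
Proof. by []. Qed.

(** [lebesgue_rV] is built from sections at a fixed first coordinate; uniqueness of the product
    measure allows slicing by lines parallel to the first axis instead, which is what a shear in the
    first coordinate requires. *)
Lemma lebesgue_rVS_ysection n (A : set 'rV[R]_(1 + n)) : measurable A ->
  lebesgue_rV A = (\int[@lebesgue_rV R n]_v lebesgue_measure [set t | A (consV (t, v))])%E.
Proof.
move=> mA; rewrite lebesgue_rVS.
have mcA : measurable (consV @^-1` A).
  by rewrite -[X in measurable X]setTI; exact: measurable_consV.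
rewrite (@product_measure_unique _ _ _ _ _ _ _ (lebesgue_measure \x^ @lebesgue_rV R n)%E) //; last first.
  by move=> X Y mX mY; exact: product_measure2E.
rewrite /product_measure2; apply: eq_integral => v _ /=; congr lebesgue_measure.
by apply/seteqP; split => t; rewrite /ysection /= inE.
Qed.

Lemma lebesgue_rVS_xsection n (A : set 'rV[R]_(1 + n)) :
  lebesgue_rV A = (\int[lebesgue_measure]_t @lebesgue_rV R n [set v | A (consV (t, v))])%E.
Proof.
rewrite lebesgue_rVS /product_measure1; apply: eq_integral => t _ /=; congr lebesgue_rV.
by apply/seteqP; split => v; rewrite /xsection /= inE.
Qed.

End consV.

Section shear.
Context {R : realType}.

Definition shear {n} (i : 'I_n) (c : 'rV[R]_n -> R) (x : 'rV[R]_n) : 'rV[R]_n :=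
  x + c x *: delta_mx ord0 i.

Lemma measurable_shear n (i : 'I_n) (c : 'rV[R]_n -> R) :
  measurable_fun setT c -> measurable_fun setT (shear i c).
Proof.
move=> mc; apply: measurable_fun_rVP => k.
have -> : (fun x => shear i c x ord0 k) = fun x => x ord0 k + c x * (delta_mx ord0 i : 'rV[R]_n) ord0 k.
  by apply/funext => x; rewrite /shear !mxE.
by apply: measurable_funD; [exact: measurable_coord|apply: measurable_funM].
Qed.

Let shear_lshift n (j : 'I_1) (c : 'rV[R]_(1 + n) -> R) t v :
  shear (lshift n j) c (consV (t, v)) = consV (t + c (consV (t, v)), v).
Proof.
apply/rowP => k; rewrite /shear !mxE /=; case: (split_ordP k) => l ->.
  by rewrite (ord1 j) (ord1 l) !eqxx mulr1 !mxE.
by rewrite eq_rlshift mulr0 addr0.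
Qed.

Let shear_rshift n (j : 'I_n) (c : 'rV[R]_(1 + n) -> R) t v :
  shear (rshift 1 j) c (consV (t, v)) = consV (t, shear j (fun v => c (consV (t, v))) v).
Proof.
apply/rowP => k; rewrite /shear !mxE /=; case: (split_ordP k) => l ->.
  by rewrite eq_lrshift mulr0 addr0.
by rewrite !mxE /= eq_rshift.
Qed.

Let consV_addl n (j : 'I_1) t (v : 'rV[R]_n) :
  consV (0, v) + t *: delta_mx ord0 (lshift n j) = consV (t, v).
Proof.
apply/rowP => k; rewrite !mxE /=; case: (split_ordP k) => l ->.
  by rewrite (ord1 j) (ord1 l) !eqxx mulr1 !mxE add0r.
by rewrite eq_rlshift mulr0 addr0.
Qed.

Let consV_addr n (j : 'I_n) t s (v : 'rV[R]_n) :
  consV (t, v) + s *: delta_mx ord0 (rshift 1 j) = consV (t, v + s *: delta_mx ord0 j).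
Proof.
apply/rowP => k; rewrite !mxE /=; case: (split_ordP k) => l ->.
  by rewrite eq_lrshift mulr0 addr0.
by rewrite !mxE /= eq_rshift.
Qed.

(** The induction follows the recursive construction of the measure. If [i] is the first coordinate,
    each line parallel to the first axis is translated by a constant, since [c] does not vary along
    it. Otherwise the first coordinate is left fixed and each slice undergoes a shear in one
    dimension less. *)
Lemma lebesgue_rV_shear n (i : 'I_n) (c : 'rV[R]_n -> R) (A : set 'rV[R]_n) :
  measurable_fun setT c -> (forall x t, c (x + t *: delta_mx ord0 i) = c x) ->
  measurable A -> lebesgue_rV (shear i c @^-1` A) = lebesgue_rV A.
Proof.
elim: n i c A => [[]//|n IH] i c A mc ci mA.
have mS : measurable (shear i c @^-1` A).
  by rewrite -[X in measurable X]setTI; exact: measurable_shear.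
have mconst t : measurable_fun setT (fun v : 'rV[R]_n => consV (t, v)).
  apply: (measurableT_comp (@measurable_consV R n)); exact: pair1_measurable.
have mconsv v : measurable_fun setT (fun t => consV (t, v : 'rV[R]_n)).
  apply: (measurableT_comp (@measurable_consV R n)); exact: pair2_measurable.
case: (@split_ordP 1 n i) => j ij; subst i.
- rewrite !lebesgue_rVS_ysection//; apply: eq_integral => v _.
  have cE t : c (consV (t, v)) = c (consV (0, v)).
    by rewrite -(ci (consV (0, v)) t); congr c; exact/esym/(consV_addl j t v).
  rewrite -[RHS](lebesgue_measure_translate (c (consV (0, v)))); last first.
    rewrite -[X in measurable X]setTI; exact: mconsv.
  by congr lebesgue_measure; apply/seteqP; split => t; rewrite /preimage /mkset -(cE t) -(shear_lshift j).
- rewrite !lebesgue_rVS_xsection; apply: eq_integral => t _.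
  rewrite -[RHS](IH j (fun v => c (consV (t, v)))).
  + by congr lebesgue_rV; apply/seteqP; split => v; rewrite /preimage /mkset -shear_rshift.
  + exact: measurableT_comp.
  + by move=> x s; rewrite -(ci (consV (t, x)) s); congr c; exact/esym/consV_addr.
  + rewrite -[X in measurable X]setTI; exact: mconst.
Qed.

End shear.

Section sphere_measurability.
Context {R : realType} {n : nat}.

Lemma measurable_unit_sphere : measurable (@unit_sphere R n).
Proof.
rewrite (_ : unit_sphere = enorm @^-1` [set 1]) //.
by rewrite -[X in measurable X]setTI; exact: measurable_enorm.
Qed.

Lemma measurable_sphere_cone (A : set 'rV[R]_n) : measurable A -> measurable (sphere_cone A).
Proof.
move=> mA.
have mp : measurable_fun setT (fun x : 'rV[R]_n => (enorm x)^-1 *: x).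
  apply: measurable_fun_rVP => i.
  have -> : (fun x : 'rV[R]_n => ((enorm x)^-1 *: x) ord0 i) = (fun x => enorm x `^ (-1) * x ord0 i).
    by apply/funext => x; rewrite mxE powR_inv1// enorm_ge0.
  apply: measurable_funM; last exact: measurable_coord.
  apply: (@measurableT_comp _ _ _ _ _ _ (@powR R ^~ (-1))) measurable_enorm.
  exact: measurable_powR.
rewrite (_ : sphere_cone A = (enorm @^-1` `]0, 1[) `&` ((fun x => (enorm x)^-1 *: x) @^-1` A)).
  apply: measurableI; rewrite -[X in measurable X]setTI; first exact: measurable_enorm.
  exact: mp.
by apply/seteqP; split => x; rewrite /= in_itv.
Qed.

Lemma integrable_sphere_bounded (f : 'rV[R]_n -> R) M : (0 < n)%N ->
  measurable_fun unit_sphere f -> (forall x, unit_sphere x -> `|f x| <= M) ->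
  (@sphere_measure R n).-integrable unit_sphere (EFin \o f).
Proof.
move=> n0 mf fM; apply: measurable_bounded_integrable => //.
- exact: measurable_unit_sphere.
- have h : @sphere_measure R n unit_sphere = 1%E by exact: sphere_measure_sphere.
  by rewrite -[X in (X < _)%E]/(@sphere_measure R n unit_sphere) h ltry.
- exists M; split; first exact: num_real.
  by move=> N MN x Sx; apply: le_trans (fM _ Sx) (ltW MN).
Qed.

Lemma integrable_sphere (f : 'rV[R]_n -> R) d : (0 < n)%N -> 1 < d ->
  {in eball d, continuous f} ->
  (@sphere_measure R n).-integrable unit_sphere (EFin \o f).
Proof.
move=> n0 d1 cf; have [M M0 fM] := bounded_eball cf d1.
apply: (integrable_sphere_bounded n0 (M := M)).
  apply: (@measurable_funS _ _ _ _ (eball d)).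
  - by apply: open_measurable_rV; exact: open_eball.
  - by move=> x /=; rewrite /eball /= => ->.
  - by apply: continuous_open_measurable_fun => //; exact: open_eball.
by move=> x /= Sx; apply: fM; rewrite Sx.
Qed.

End sphere_measurability.

Section rotation.
Context {R : realType} {n : nat}.
Variables (i j : 'I_n).
Hypothesis ij : i != j.
Implicit Types (a : R) (x : 'rV[R]_n).

(* Half-angle parametrization of the rotation in the (i, j)-plane: the angle is 2 arctan a. *)
Definition rot_cos a := (1 - a ^+ 2) / (1 + a ^+ 2).
Definition rot_sin a := 2 * a / (1 + a ^+ 2).

Definition plane_rot a x : 'rV[R]_n := \row_k
  if k == i then rot_cos a * x ord0 i - rot_sin a * x ord0 j
  else if k == j then rot_sin a * x ord0 i + rot_cos a * x ord0 j else x ord0 k.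

Let den_neq0 a : 1 + a ^+ 2 != 0.
Proof. by rewrite gt_eqF// ltr_wpDr// sqr_ge0. Qed.

(** The classical factorization of a rotation of angle $\theta$ into shears of coefficients
    $-\tan(\theta/2)$, $\sin\theta$, $-\tan(\theta/2)$. With [a] equal to $\tan(\theta/2)$ it is an
    identity of rational functions whose only denominator is $1+a^2$. *)
Lemma rot_shear a x : plane_rot a x =
  shear i (fun y => - a * y ord0 j) (shear j (fun y => rot_sin a * y ord0 i)
    (shear i (fun y => - a * y ord0 j) x)).
Proof.
have /negbTE ji : j != i by rewrite eq_sym.
apply/rowP => k; rewrite /shear /plane_rot !mxE !eqxx ?ji ?(negbTE ij) /=.
rewrite /rot_cos /rot_sin.
case: ifPn => [/eqP ->|ki]; rewrite ?eqxx ?(negbTE ij) /=.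
  by rewrite !(mulr0, mulr1, addr0); field; exact: den_neq0.
case: ifPn => [/eqP ->|kj]; rewrite /= ?eqxx ?ji /=.
  by rewrite !(mulr0, mulr1, addr0); field; exact: den_neq0.
by rewrite ?(negbTE ki) !(mulr0, mulr1, addr0).
Qed.

Lemma measurable_rot a : measurable_fun setT (plane_rot a).
Proof.
have m1 b (k l : 'I_n) : measurable_fun setT (shear k (fun y : 'rV[R]_n => b * y ord0 l)).
  by apply: measurable_shear; apply: measurable_funM => //; exact: measurable_coord.
rewrite (_ : plane_rot a = shear i (fun y => - a * y ord0 j) \o
  (shear j (fun y => rot_sin a * y ord0 i) \o (shear i (fun y => - a * y ord0 j)))).
  by do 2 apply: measurableT_comp => //.
by apply/funext => x; exact: rot_shear.
Qed.

Lemma lebesgue_rV_rot a (A : set 'rV[R]_n) : measurable A ->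
  lebesgue_rV (plane_rot a @^-1` A) = lebesgue_rV A.
Proof.
move=> mA.
have /negbTE ji : j != i by rewrite eq_sym.
have mf b (l : 'I_n) : measurable_fun setT (fun y : 'rV[R]_n => b * y ord0 l).
  by apply: measurable_funM => //; exact: measurable_coord.
have m1 b (k l : 'I_n) B : measurable B ->
    measurable (shear k (fun y : 'rV[R]_n => b * y ord0 l) @^-1` B).
  by move=> mB; rewrite -[X in measurable X]setTI; exact: measurable_shear.
pose S := shear i (fun y => - a * y ord0 j) @^-1` A.
pose S' := shear j (fun y => rot_sin a * y ord0 i) @^-1` S.
rewrite (_ : _ @^-1` _ = shear i (fun y => - a * y ord0 j) @^-1` S'); last first.
  by rewrite predeqE => x; rewrite /S' /S /= rot_shear.
rewrite lebesgue_rV_shear//; [|by move=> x t; rewrite !mxE ji mulr0 addr0|by rewrite /S'/S; auto].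
rewrite lebesgue_rV_shear//; [|by move=> x t; rewrite !mxE (negbTE ij) mulr0 addr0|by rewrite /S; auto].
by rewrite lebesgue_rV_shear// => x t; rewrite !mxE ji mulr0 addr0.
Qed.

Lemma enorm_rot a x : enorm (plane_rot a x) = enorm x.
Proof.
have /negbTE ji : j != i by rewrite eq_sym.
congr Num.sqrt; rewrite (bigD1 i)//= (bigD1 j)/=; last by rewrite eq_sym.
rewrite [RHS](bigD1 i)//= [X in _ = _ + X](bigD1 j)/=; last by rewrite eq_sym.
rewrite !addrA; congr (_ + _); last first.
  by apply: eq_bigr => k /andP[/negbTE ki /negbTE kj]; rewrite mxE ki kj.
rewrite !mxE !eqxx ji /rot_cos /rot_sin; field; exact: den_neq0.
Qed.

Lemma rotZ a t x : plane_rot a (t *: x) = t *: plane_rot a x.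
Proof.
apply/rowP => k; rewrite !mxE.
by case: ifP => _; [ring|case: ifP => _; ring].
Qed.

(** Rotations commute with dilations and preserve [enorm], hence the cone over a rotated set is the
    rotated cone, and the invariance of volume applies. *)
Lemma sphere_measure_rot a (A : set 'rV[R]_n) : measurable A ->
  sphere_measure (plane_rot a @^-1` A) = sphere_measure A.
Proof.
move=> mA; rewrite /sphere_measure /surface_measure.
congr (_ * _ * _)%E; rewrite -[RHS](lebesgue_rV_rot a); last exact: measurable_sphere_cone.
congr lebesgue_rV; rewrite predeqE => x.
by rewrite /sphere_cone /= -rotZ enorm_rot.
Qed.

Lemma preimage_rot_sphere a : plane_rot a @^-1` unit_sphere = unit_sphere.
Proof. by rewrite predeqE => x; rewrite /unit_sphere /= enorm_rot. Qed.

Lemma integral_sphere_rot a (f : 'rV[R]_n -> R) M :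
  measurable_fun unit_sphere f -> (forall x, unit_sphere x -> `|f x| <= M) ->
  \int[@sphere_measure R n]_(z in unit_sphere) f (plane_rot a z) =
  \int[@sphere_measure R n]_(z in unit_sphere) f z.
Proof.
move=> mf fM; have mS := @measurable_unit_sphere R n.
have n0 : (0 < n)%N by apply: leq_ltn_trans (ltn_ord i).
(* Extension by zero makes the function measurable on the whole space; nothing changes in the
   integrals, since the rotation maps the sphere to itself. *)
pose g := f \_ unit_sphere.
have mg : measurable_fun setT g by apply/(measurable_restrictT _ _).1.
rewrite (@eq_Rintegral _ _ _ _ _ (fun z => g (plane_rot a z))); last first.
  move=> z /[!inE] Sz; rewrite /g patchE mem_set//.
  by rewrite /unit_sphere /= enorm_rot.
rewrite [RHS](@eq_Rintegral _ _ _ _ _ g); last by move=> z Sz; rewrite /g patchE Sz.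
rewrite /Rintegral; congr fine.
rewrite -[in LHS](preimage_rot_sphere a).
rewrite -(@integral_pushforward _ _ _ _ _ _ (measurable_rot a) _ _ (EFin \o g))//.
- by apply: eq_measure_integral => [|mr A mA _]; [exact: measurable_rot|exact: sphere_measure_rot].
- exact/measurable_EFinP.
- rewrite preimage_rot_sphere; apply: (integrable_sphere_bounded (M := M)) => //.
    by apply: measurable_funTS; apply: measurableT_comp => //; exact: measurable_rot.
  by move=> x Sx; rewrite /g patchE mem_set /unit_sphere /= ?enorm_rot// fM// /unit_sphere /= enorm_rot.
Qed.

End rotation.

(** * Chain rule along curves *)

Section slopes.
Context {R : realType} {n : nat}.
Implicit Types (f : 'rV[R]_n -> R) (D : set 'rV[R]_n) (x y : 'rV[R]_n).

Definition C1_in D f : Prop :=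
  [/\ {in D, continuous f}, derivable_in D f & forall i, {in D, continuous (partial i f)}].

Lemma is_derive_line f y (i : 'I_n) (t : R) : derivable f (y + t *: delta_mx ord0 i) (delta_mx ord0 i) ->
  is_derive t (1:R) (fun s => f (y + s *: delta_mx ord0 i)) (partial i f (y + t *: delta_mx ord0 i)).
Proof.
set e := delta_mx _ _ => df.
have E : (fun h : R => h^-1 *: (((fun s => f (y + s *: e)) \o shift t) (h *: 1) - f (y + t *: e))) =
   (fun h : R => h^-1 *: ((f \o shift (y + t *: e)) (h *: e) - f (y + t *: e))).
  apply/funext => h /=; congr (_ *: (f _ - _)).
  by rewrite scaler1 scalerDl addrCA.
by split; rewrite /derivable /derive E.
Qed.

(** Vertices of the path from [x] to [y] that changes one coordinate at a time, so that only partial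
    derivatives are met along its edges. *)
Let mid x y k : 'rV[R]_n := \row_(j < n) if (j < k)%N then y ord0 j else x ord0 j.

(** The difference quotient along the [i]-th edge of that path. On a degenerate edge the default is
    the limit sought, which keeps the function continuous at [x]. *)
Let slope f x (i : 'I_n) y := if y ord0 i == x ord0 i then partial i f x
  else (f (mid x y i.+1) - f (mid x y i)) / (y ord0 i - x ord0 i).

Let mid0 x y : mid x y 0 = x.
Proof. by apply/rowP => j; rewrite mxE. Qed.

Let midn x y : mid x y n = y.
Proof. by apply/rowP => j; rewrite mxE ltn_ord. Qed.

Let midS x y (i : 'I_n) : mid x y i.+1 = mid x y i + (y ord0 i - x ord0 i) *: delta_mx ord0 i.
Proof.
apply/rowP => j; rewrite !mxE eqxx /= ltnS leq_eqVlt.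
case: (ltngtP j i) => [ji|ij|/val_inj ->]; rewrite ?orbT ?eqxx /=.
- rewrite (_ : j == i = false); last by apply/negP => /eqP E; rewrite E ltnn in ji.
  by rewrite mulr0 addr0.
- rewrite (_ : j == i = false); last by apply/negP => /eqP E; rewrite E ltnn in ij.
  by rewrite mulr0 addr0.
- by rewrite mulr1; ring.
Qed.

Let slope_sum f x y : f y = f x + \sum_i slope f x i y * (y ord0 i - x ord0 i).
Proof.
rewrite (eq_bigr (fun i : 'I_n => f (mid x y i.+1) - f (mid x y i))); last first.
  move=> i _; rewrite /slope; case: eqP => [E|/eqP E].
    by rewrite midS E subrr scale0r addr0 subrr mulr0.
  by rewrite divfK// subr_eq0.
rewrite -(big_mkord xpredT (fun i => f (mid x y i.+1) - f (mid x y i))).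
by rewrite telescope_sumr// midn mid0 addrC subrK.
Qed.

(** By the mean value theorem the slope is the value of the partial derivative at some point of the
    edge, and that point tends to [x] together with [y]. *)
Let slope_cvg f D x i : open D -> D x -> C1_in D f ->
  slope f x i y @[y --> x] --> partial i f x.
Proof.
move=> oD Dx [_ df cf].
apply/(@cvgrPdist_le _ _ _ (nbhs x) (nbhs_filter x)) => e e0.
have xD : nbhs x D by exact: open_nbhs_nbhs.
have : nbhs x (D `&` [set z | `|partial i f x - partial i f z| <= e]).
  apply: filterI => //; have /(_ x) := cf i; rewrite inE => /(_ Dx).
  by move=> /cvgrPdist_le; exact.
move=> /nbhs_ballP[d /= d0 dP].
apply/nbhs_ballP; exists d => //= y xy.
rewrite /slope; case: eqP => [_|/eqP yx]; first by rewrite subrr normr0 ltW.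
pose p t := mid x y i + t *: delta_mx ord0 i.
pose a := y ord0 i - x ord0 i.
have a0 : a != 0 by rewrite subr_eq0.
(* Balls are cubes here, so an edge of the path is no farther from [x] than its endpoint [y]. *)
have pP t : `|t| <= `|a| -> ball x d (p t).
  move=> ta; split => // j k; rewrite (ord1 j) -ball_normE /=.
  have xyk : `|x ord0 k - y ord0 k| < d by case: xy => _ /(_ ord0 k); rewrite -ball_normE.
  rewrite !mxE eqxx /=; case: (eqVneq k i) => [->|ki].
    rewrite ltnn mulr1 opprD addrA subrr add0r normrN (le_lt_trans ta)//.
    by rewrite /a distrC; case: xy => _ /(_ ord0 i); rewrite -ball_normE.
  by rewrite mulr0 addr0; case: ifP => _ //; rewrite subrr normr0.
have dp t : `|t| <= `|a| -> is_derive t (1:R) (fun s => f (p s)) (partial i f (p t)).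
  by move=> ta; apply: is_derive_line; apply: df; have [] := dP _ (pP _ ta).
have fp0 : f (mid x y i) = f (p 0) by rewrite /p scale0r addr0.
have fpa : f (mid x y i.+1) = f (p a) by rewrite midS.
rewrite fp0 fpa -/a.
have cp (s t : R) : (forall z, z \in `[s, t] -> `|z| <= `|a|) ->
    {within `[s, t], continuous (fun z => f (p z))}.
  move=> h; apply: continuous_in_subspaceT => z /[!inE] zst.
  apply: differentiable_continuous; apply/derivable1_diffP.
  by have [] := dp z (h z zst).
suff [t ta ->] : exists2 t, `|t| <= `|a| & f (p a) - f (p 0) = partial i f (p t) * a.
  by rewrite mulfK//; have [_] := dP _ (pP _ ta).
(* The mean value theorem is stated on an ordered interval, so the two orientations of the edge are
   separate cases. *)
have [a_gt0|a_lt0|a_eq0] := ltgtP 0 a; last by rewrite -a_eq0 eqxx in a0.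
- have h z : z \in `[0, a] -> `|z| <= `|a|.
    by rewrite in_itv/= => /andP[z0 za]; rewrite !ger0_norm// ltW.
  have [t ta E] := MVT a_gt0 (fun z zi => dp z (h z (subset_itv_oo_cc zi))) (cp _ _ h).
  exists t; first exact: h (subset_itv_oo_cc ta).
  by rewrite E subr0.
- have h z : z \in `[a, 0] -> `|z| <= `|a|.
    rewrite in_itv/= => /andP[az z0]; rewrite ler0_norm// ler0_norm; last exact: ltW.
    by rewrite lerN2.
  have [t ta E] := MVT a_lt0 (fun z zi => dp z (h z (subset_itv_oo_cc zi))) (cp _ _ h).
  exists t; first exact: h (subset_itv_oo_cc ta).
  by rewrite -opprB E sub0r mulrN opprK.
Qed.

(* Caratheodory form of differentiability: slopes converge, no linear map or little-o needed. *)
Lemma C1_slopes f D x : open D -> D x -> C1_in D f ->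
  exists A : 'I_n -> 'rV[R]_n -> R,
    (forall i, A i y @[y --> x] --> partial i f x) /\
    (forall y, f y = f x + \sum_i A i y * (y ord0 i - x ord0 i)).
Proof.
move=> oD Dx cf; exists (slope f x); split; last exact: slope_sum.
by move=> i; exact: slope_cvg cf.
Qed.

End slopes.

Lemma cvg_sumr {R : realType} (T : Type) (F : set_system T) (FF : Filter F)
    (I : Type) (r : seq I) (f : I -> T -> R) (l : I -> R) :
  (forall i, f i t @[t --> F] --> l i) ->
  \sum_(i <- r) f i t @[t --> F] --> \sum_(i <- r) l i.
Proof.
move=> fl; elim: r => [|i r IH].
  rewrite big_nil (_ : (fun _ => _) = fun=> 0); first exact: cvg_cst.
  by apply/funext => t; rewrite big_nil.
rewrite big_cons (_ : (fun _ => _) = fun t => f i t + \sum_(i <- r) f i t); last first.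
  by apply/funext => t; rewrite big_cons.
exact: cvgD.
Qed.

(** Inserting the slopes into the difference quotient writes it as a finite sum of products, each of
    a quotient of one coordinate of the curve and a slope evaluated along the curve; both factors
    converge. *)
Lemma is_derive_curve {R : realType} {n} (f : 'rV[R]_n -> R) D (c : R -> 'rV[R]_n)
    (dc : 'rV[R]_n) (t : R) : open D -> D (c t) -> C1_in D f ->
  (forall i, is_derive t (1:R) (fun s => c s ord0 i) (dc ord0 i)) ->
  is_derive t (1:R) (fun s => f (c s)) (\sum_i dc ord0 i * partial i f (c t)).
Proof.
move=> oD Dc cf dcP.
have [A [Acvg AE]] := C1_slopes oD Dc cf.
have ccont : c h @[h --> t] --> c t.
  apply/cvgrPdist_lt => /= e e0.
  have h i : \forall s \near t, `|c t ord0 i - c s ord0 i| < e.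
    have [/derivable1_diffP/differentiable_continuous + _] := dcP i.
    by move=> /cvgrPdist_lt h1; exact: (h1 e e0).
  apply: filterS (filter_forall (nbhs_filter t) h) => s hs.
  rewrite [ltLHS]/Num.norm /= mx_normrE; apply/bigmax_ltP; split => // -[k l] _ /=.
  by rewrite (ord1 k) !mxE; exact: hs.
have st : (h *: (1 : R) + t) @[h --> 0^'] --> t.
  apply/cvgrPdist_lt => e e0; near=> h.
  rewrite scaler1 opprD addrCA subrr addr0 normrN.
  by near: h; exact: dnbhs0_lt.
have key : h^-1 *: (f (c (h *: (1 : R) + t)) - f (c t)) @[h --> 0^'] -->
    \sum_i dc ord0 i * partial i f (c t).
  rewrite (_ : (fun _ => _) = fun h => \sum_i (h^-1 *: (c (h *: (1 : R) + t) ord0 i - c t ord0 i))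
      * A i (c (h *: (1 : R) + t))); last first.
    apply/funext => h; rewrite (AE (c (h *: 1 + t))) addrAC subrr add0r scaler_sumr.
    by apply: eq_bigr => i _; rewrite mulrC scalerAl.
  apply: cvg_sumr => i; apply: cvgM.
    have [d1 d2] := dcP i; rewrite -d2; exact: d1.
  apply: (cvg_comp (fun h : R => c (h *: (1 : R) + t)) (A i)) (Acvg i).
  exact: (cvg_comp (fun h : R => h *: (1 : R) + t) c) ccont.
split; first by apply/cvg_ex; eexists; exact: key.
by apply/cvg_lim => //; exact: key.
Unshelve. all: by end_near. Qed.

(** * Integrals over spheres *)

Lemma Rintegral_sum {d} {T : measurableType d} {R : realType}
    (mu : {measure set T -> \bar R}) (D : set T) (I : Type) (r : seq I) (f : I -> T -> R) :
  measurable D -> (forall i, mu.-integrable D (EFin \o f i)) ->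
  mu.-integrable D (EFin \o (fun x => \sum_(i <- r) f i x)) /\
  \int[mu]_(x in D) (\sum_(i <- r) f i x) = \sum_(i <- r) \int[mu]_(x in D) f i x.
Proof.
move=> mD intf; elim: r => [|i r [IH1 IH2]].
  rewrite big_nil (_ : (fun _ => _) = fun=> 0); last by apply/funext => x; rewrite big_nil.
  by split; [exact: integrable0|rewrite Rintegral_cst// mul0r].
rewrite big_cons (_ : (fun _ => _) = fun x => f i x + \sum_(i <- r) f i x); last first.
  by apply/funext => x; rewrite big_cons.
split; last by rewrite RintegralD// IH2.
exact: (integrableD mD (intf i) IH1).
Qed.

Lemma is_derive_under_integral {d} {Y : measurableType d} {R : realType}
    (mu : {measure set Y -> \bar R}) (f df : R -> Y -> R) (B : set Y) (a u v M : R) :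
  measurable B -> (mu B < +oo)%E -> a \in `]u, v[ ->
  (forall x, x \in `]u, v[ -> mu.-integrable B (EFin \o f x)) ->
  (forall x y, x \in `]u, v[ -> B y -> is_derive x (1 : R) (f ^~ y) (df x y)) ->
  (forall x y, x \in `]u, v[ -> B y -> `|df x y| <= M) ->
  is_derive a (1 : R) (fun x => \int[mu]_(y in B) f x y) (\int[mu]_(y in B) df a y).
Proof.
move=> mB Boo auv intf fdf dfM.
(* The absolute value is there because a dominating function has to be nonnegative everywhere,
   whereas the sign of [M] is not given. *)
pose G : Y -> R := cst `|M|.
have G_ge0 y : 0 <= G y by exact: normr_ge0.
have intM : mu.-integrable B (EFin \o G).
  apply: measurable_bounded_integrable => //; [exact: measurable_cst|exact: bounded_cst].
have derf x y : `]u, v[%classic x -> B y -> derivable (f ^~ y) x 1.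
  by move=> xuv By; have [] := fdf x y xuv By.
have d1E x y : x \in `]u, v[ -> B y -> partial1of2 f x y = df x y.
  by move=> xuv By; rewrite partial1of2E; have [_ ->] := fdf x y xuv By.
have d1M x y : `]u, v[%classic x -> B y -> `|partial1of2 f x y| <= G y.
  by move=> xuv By; rewrite d1E//= (le_trans (dfM _ _ xuv By))// ler_norm.
split.
  exact: (derivable_under_integral mB auv intf derf G_ge0 intM d1M).
rewrite -derive1E (differentiation_under_integral mB auv intf derf G_ge0 intM d1M).
by apply: eq_Rintegral => y /[!inE] By; rewrite d1E.
Qed.

Section sphere_integral.
Context {R : realType} {n : nat}.
Hypothesis n_gt0 : (0 < n)%N.
Local Notation sigma := (@sphere_measure R n).
Local Notation S := (@unit_sphere R n).
Implicit Types (w h : 'rV[R]_n -> R) (s : R) (z : 'rV[R]_n).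

(** The weight [w] is fixed on the unit sphere while [h] is dilated: differentiation in [s] yields
    factors $z_j$, which the weight absorbs, so sums of such integrals are stable under
    differentiation. *)
Definition sphere_int w h s : R := \int[sigma]_(z in S) (w z * h (s *: z)).

Lemma sphere_measure_fin : (sigma S < +oo)%E.
Proof.
have h : sigma S = 1%E by exact: sphere_measure_sphere.
by rewrite -[X in (X < _)%E]/(sphere_measure S) h ltry.
Qed.

Lemma unit_ball_sphere s z : `|s| < 1 -> S z -> unit_ball (s *: z).
Proof. by move=> s1; rewrite /unit_ball /= enormZ => ->; rewrite mulr1. Qed.

Lemma integrable_sphere_int w h s : continuous w -> {in unit_ball, continuous h} ->
  `|s| < 1 -> sigma.-integrable S (EFin \o (fun z => w z * h (s *: z))).
Proof.
move=> cw ch s1; have p : 0 < 1 + `|s| by rewrite ltr_pwDl.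
(* A radius above $1$ whose dilation by $|s|$ is $2|s|/(1+|s|)<1$: the integrand is continuous on a
   neighbourhood of the closed unit ball. *)
apply: (@integrable_sphere _ _ _ (2 / (1 + `|s|))) => //.
  by rewrite ltr_pdivlMr// mul1r; lra.
move=> z /[!inE] zd; apply: continuousM; first exact: cw.
apply: (@continuous_comp _ _ _ (fun z => s *: z) h); first exact: scaler_continuous.
apply: ch; rewrite inE /unit_ball /= enormZ.
move: zd; rewrite /eball /= ltr_pdivlMr// => zd.
have := enorm_ge0 z; have := normr_ge0 s.
move: (enorm z) (`|s|) zd s1 p => a b; nra.
Qed.

Lemma is_derive_sphere_int w h s : continuous w -> C1_in unit_ball h -> `|s| < 1 ->
  is_derive s (1 : R) (sphere_int w h)
    (\sum_j sphere_int (fun z => w z * z ord0 j) (partial j h) s).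
Proof.
move=> cw ch s1; have [ch0 _ ch1] := ch.
have mS := @measurable_unit_sphere R n.
have cwz j : continuous (fun z => w z * z ord0 j).
  by move=> z; apply: continuousM; [exact: cw|exact: continuous_coord].
have E : \sum_j sphere_int (fun z => w z * z ord0 j) (partial j h) s =
    \int[sigma]_(z in S) \sum_j (w z * z ord0 j * partial j h (s *: z)).
  rewrite (Rintegral_sum _ _ _).2 // => j.
  exact: integrable_sphere_int.
rewrite E.
(* The midpoint between $|s|$ and $1$: for parameters in $]-c,c[$ the dilated sphere stays in a
   compact ball, where the partial derivatives are bounded uniformly. *)
pose c := (1 + `|s|) / 2.
have sc : `|s| < c by rewrite /c; lra.
have c1 : c < 1 by rewrite /c; lra.
have bw j : {M | 0 <= M & forall x, x \in `]-c, c[ -> forall z, S z ->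
    `|w z * z ord0 j * partial j h (x *: z)| <= M}.
  apply: cid2.
  have [M1 M10 hM1] := bounded_eball (ch1 j) c1.
  have cwzj : {in eball 2, continuous (fun z : 'rV[R]_n => w z * z ord0 j)} by move=> z _; exact: cwz.
  have [M2 M20 hM2] := bounded_eball cwzj (ltr1n R 2).
  exists (M2 * M1); first exact: mulr_ge0.
  move=> x; rewrite in_itv/= -ltr_norml => xc z Sz; rewrite normrM ler_pM//.
    by apply: hM2; rewrite Sz.
  by apply: hM1; rewrite enormZ Sz mulr1 ltW.
pose M := \sum_j s2val (bw j).
apply: (@is_derive_under_integral _ _ _ _ _
  (fun s z => \sum_j (w z * z ord0 j * partial j h (s *: z))) _ _ (-c) c M) => //.
- exact: sphere_measure_fin.
- by rewrite in_itv/= -ltr_norml.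
- move=> x; rewrite in_itv/= -ltr_norml => xc; apply: integrable_sphere_int => //.
  exact: lt_trans c1.
- move=> x z; rewrite in_itv/= -ltr_norml => xc Sz.
  have x1 := lt_trans xc c1.
  have dh : is_derive x (1 : R) (fun s => h (s *: z)) (\sum_j z ord0 j * partial j h (x *: z)).
    apply: (is_derive_curve (D := unit_ball) (c := fun s => s *: z)) => //.
    - exact: open_eball.
    - exact: unit_ball_sphere.
    - move=> j; rewrite (_ : (fun _ => _) = fun s => s * z ord0 j); last by apply/funext => t; rewrite mxE.
      by apply: is_derive_eq; rewrite scaler0 add0r; exact: mulr1.
  have -> : \sum_j w z * z ord0 j * partial j h (x *: z) =
      w z * \sum_j z ord0 j * partial j h (x *: z).
    by rewrite mulr_sumr; apply: eq_bigr => j _; rewrite mulrA.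
  exact: (is_deriveZ (w z) dh).
- move=> x z xc Sz; rewrite (le_trans (ler_norm_sum _ _ _))// ler_sum// => j _.
  exact: (s2valP' (bw j)).
Qed.

End sphere_integral.

(** * Infinitesimal form of rotation invariance *)

Section rotation_derivative.
Context {R : realType}.
Implicit Type a : R.

Let rc' a := - (4 * a) / (1 + a ^+ 2) ^+ 2.
Let rs' a := 2 * (1 - a ^+ 2) / (1 + a ^+ 2) ^+ 2.

Let den_neq0 a : 1 + a ^+ 2 != 0.
Proof. by rewrite gt_eqF// ltr_wpDr// sqr_ge0. Qed.

Let is_derive_den a : is_derive a (1 : R) (fun a => (1 + a ^+ 2)^-1) (- (2 * a) / (1 + a ^+ 2) ^+ 2).
Proof.
have d : is_derive a (1 : R) (fun a => 1 + a ^+ 2) (2 * a).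
  by apply: is_derive_eq; rewrite /GRing.scale /=; ring.
have := is_deriveV (f := fun a => 1 + a ^+ 2) (den_neq0 a) d.
by move=> h; apply: is_derive_eq; rewrite /GRing.scale /= -exprVn; ring.
Qed.

Lemma is_derive_rot_cos a : is_derive a (1 : R) (@rot_cos R) (rc' a).
Proof.
have d : is_derive a (1 : R) (fun a => 1 - a ^+ 2) (- (2 * a)).
  by apply: is_derive_eq; rewrite /GRing.scale /=; ring.
have := is_deriveM d (is_derive_den a); move=> h.
by apply: is_derive_eq; rewrite /GRing.scale /= /rc'; field; exact: den_neq0.
Qed.

Lemma is_derive_rot_sin a : is_derive a (1 : R) (@rot_sin R) (rs' a).
Proof.
have d : is_derive a (1 : R) (fun a => 2 * a) 2.
  by apply: is_derive_eq; rewrite /GRing.scale /=; ring.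
have := is_deriveM d (is_derive_den a); move=> h.
by apply: is_derive_eq; rewrite /GRing.scale /= /rs'; field; exact: den_neq0.
Qed.

Let den_ge1 a : 1 <= (1 + a ^+ 2) ^+ 2.
Proof. by rewrite exprn_ege1// lerDl sqr_ge0. Qed.

Let rc'_le a : `|a| <= 1 -> `|rc' a| <= 4.
Proof.
move=> a1; rewrite /rc' normrM normrN normfV ler_pdivrMr; last first.
  by rewrite normr_gt0 expf_neq0.
rewrite [leRHS]mulrC -[leLHS]mul1r ler_pM//.
  by rewrite ger0_norm// (le_trans _ (den_ge1 a)).
by rewrite normrM ger0_norm// ler_piMr.
Qed.

Let rs'_le a : `|a| <= 1 -> `|rs' a| <= 2.
Proof.
move=> a1; rewrite /rs' normrM normfV ler_pdivrMr; last first.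
  by rewrite normr_gt0 expf_neq0.
rewrite [leRHS]mulrC -[leLHS]mul1r ler_pM//.
  by rewrite ger0_norm// (le_trans _ (den_ge1 a)).
have : a ^+ 2 <= 1 by rewrite -real_normK ?num_real// exprn_ile1.
have := sqr_ge0 a => ? ?; rewrite normrM ger0_norm// ler_piMr// ger0_norm; lra.
Qed.

Context {n : nat}.
Local Notation sigma := (@sphere_measure R n).
Local Notation S := (@unit_sphere R n).
Variables (i j : 'I_n).
Hypothesis ij : i != j.

Let n_gt0 : (0 < n)%N. Proof. by apply: leq_ltn_trans (ltn_ord i). Qed.

(** The velocity at parameter [a] of the curve that carries the point [s *: z] along its rotation
    orbit. *)
Let dc s a (z : 'rV[R]_n) : 'rV[R]_n := \row_k (s *
  (if k == i then rc' a * z ord0 i - rs' a * z ord0 j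
   else if k == j then rs' a * z ord0 i + rc' a * z ord0 j else 0)).

Let is_derive_rot s a z k :
  is_derive a (1 : R) (fun a => (s *: plane_rot i j a z) ord0 k) (dc s a z ord0 k).
Proof.
have dcos := is_derive_rot_cos a; have dsin := is_derive_rot_sin a.
rewrite mxE; have [ki|ki] := eqVneq k i.
  rewrite (_ : (fun _ => _) = fun a => s * (rot_cos a * z ord0 i - rot_sin a * z ord0 j)).
    by apply: is_derive_eq; rewrite /GRing.scale /=; ring.
  by apply/funext => b; rewrite !mxE ki eqxx.
have [kj|kj] := eqVneq k j.
  rewrite (_ : (fun _ => _) = fun a => s * (rot_sin a * z ord0 i + rot_cos a * z ord0 j)).
    by apply: is_derive_eq; rewrite /GRing.scale /=; ring.
  by apply/funext => b; rewrite !mxE (negbTE ki) kj eqxx.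
rewrite (_ : (fun _ => _) = fun a => s * z ord0 k).
  by apply: is_derive_eq; rewrite /GRing.scale /=; ring.
by apply/funext => b; rewrite !mxE (negbTE ki) (negbTE kj).
Qed.

Let dc_le s a z k : `|s| < 1 -> `|a| <= 1 -> S z -> `|dc s a z ord0 k| <= 6.
Proof.
move=> /ltW s1 a1 Sz; rewrite mxE normrM -[leRHS]mul1r ler_pM//.
have zk l : `|z ord0 l| <= 1 by rewrite -Sz coord_le_enorm.
have := rc'_le a1; have := rs'_le a1 => h1 h2.
have b (p q : R) (c d : R) : `|p| <= c -> `|q| <= d -> c + d = 6 -> `|p + q| <= 6.
  by move=> pc qd <-; rewrite (le_trans (ler_normD _ _))// lerD.
have m (p q c : R) : `|p| <= c -> `|q| <= 1 -> `|p * q| <= c.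
  by move=> pc q1; rewrite normrM -[leRHS]mulr1 ler_pM.
case: ifP => _; last case: ifP => _; last by rewrite normr0.
  by apply: (b _ _ 4 2); rewrite ?normrN; [exact: m|exact: m|ring].
by apply: (b _ _ 2 4); [exact: m|exact: m|ring].
Qed.

(** The mean of [h] over a rotated sphere does not depend on the parameter [a], so its derivative at
    $a=0$ vanishes. The factor [s] is the size of the orbit; leaving it in place covers $s=0$. *)
Lemma sphere_int_rot (h : 'rV[R]_n -> R) s : C1_in unit_ball h -> `|s| < 1 ->
  s * sphere_int (fun z => z ord0 i) (partial j h) s =
  s * sphere_int (fun z => z ord0 j) (partial i h) s.
Proof.
move=> ch s1; have [ch0 _ ch1] := ch.
have mS := @measurable_unit_sphere R n.
have c1 : continuous (fun _ : 'rV[R]_n => 1 : R) by move=> z; exact: cst_continuous.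
have cp (f : 'rV[R]_n -> R) : {in unit_ball, continuous f} ->
    measurable_fun S (fun z => f (s *: z)).
  move=> cf; have /integrableP[/measurable_EFinP] :=
    @integrable_sphere_int R n n_gt0 (fun=> 1) f s c1 cf s1.
  by under eq_fun do rewrite mul1r.
have bnd (f : 'rV[R]_n -> R) : {in unit_ball, continuous f} ->
    {M | 0 <= M & forall z, S z -> `|f (s *: z)| <= M}.
  move=> cf; apply: cid2; have [M M0 fM] := @bounded_eball R n f `|s| 1 cf s1.
  by exists M => // z Sz; apply: fM; rewrite enormZ Sz mulr1.
have Srot a z : S z -> S (plane_rot i j a z) by rewrite /unit_sphere /= enorm_rot.
pose M := \sum_k 6 * s2val (bnd _ (ch1 k)).
have J : is_derive 0 (1 : R) (fun a => \int[sigma]_(z in S) h (s *: plane_rot i j a z))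
    (\int[sigma]_(z in S) \sum_k dc s 0 z ord0 k * partial k h (s *: plane_rot i j 0 z)).
  apply: (@is_derive_under_integral _ _ _ _ _
    (fun a z => \sum_k dc s a z ord0 k * partial k h (s *: plane_rot i j a z)) _ _ (-1) 1 M) => //.
  - exact: sphere_measure_fin.
  - by rewrite in_itv/= ltrN10 ltr01.
  - move=> a _; have [N N0 hN] := bnd _ ch0.
    apply: (integrable_sphere_bounded n_gt0 (M := N)); last by move=> z Sz; apply/hN/Srot.
    apply: (@measurable_comp _ _ _ _ _ _ S (fun z => h (s *: z)) _ (plane_rot i j a)) => //.
    + by move=> _ [z Sz <-]; exact: Srot.
    + exact: cp.
    + by apply: measurable_funTS; exact: measurable_rot.
  - move=> a z _ Sz; apply: (is_derive_curve (D := unit_ball) (c := fun a => s *: plane_rot i j a z)) => //.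
    + exact: open_eball.
    + exact/unit_ball_sphere/Srot.
  - move=> a z; rewrite in_itv/= -ltr_norml => /ltW a1 Sz.
    rewrite (le_trans (ler_norm_sum _ _ _))// ler_sum// => k _.
    rewrite normrM ler_pM//; first exact: dc_le.
    by apply: (s2valP' (bnd _ (ch1 k))); exact: Srot.
have J0 : (fun a => \int[sigma]_(z in S) h (s *: plane_rot i j a z)) =
    cst (\int[sigma]_(z in S) h (s *: z)).
  apply/funext => a; have [N N0 hN] := bnd _ ch0.
  exact: (@integral_sphere_rot _ _ _ _ ij a (fun z => h (s *: z)) N (cp _ ch0) hN).
have [_] := J; rewrite J0 derive_cst => /esym E.
have rot0 (z : 'rV[R]_n) : plane_rot i j 0 z = z.
  have c0 : @rot_cos R 0 = 1 by rewrite /rot_cos; field.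
  have s0 : @rot_sin R 0 = 0 by rewrite /rot_sin; field.
  apply/rowP => k; rewrite !mxE c0 s0 !mul1r !mul0r subr0 add0r.
  by case: eqP => [->//|_]; case: eqP => [->|].
(* The factor $2$ is the angular speed at $a=0$, the angle being $2\arctan a$; the cosine has
   derivative $0$ there. *)
have E2 : \int[sigma]_(z in S) (2 * s * (z ord0 i * partial j h (s *: z) - z ord0 j * partial i h (s *: z))) = 0.
  rewrite -[RHS]E; apply: eq_Rintegral => z _; rewrite rot0.
  rewrite (bigD1 i)//= (bigD1 j)/=; last by rewrite eq_sym.
  rewrite big1 ?addr0; last by move=> k /andP[/negbTE ki /negbTE kj]; rewrite mxE ki kj mulr0 mul0r.
  rewrite !mxE !eqxx [j == i]eq_sym (negbTE ij) /rc' /rs' expr0n /=.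
  by field.
have iI (k l : 'I_n) : sigma.-integrable S (EFin \o (fun z : 'rV[R]_n => z ord0 k * partial l h (s *: z))).
  by apply: integrable_sphere_int => // z; exact: continuous_coord.
have iD : sigma.-integrable S (EFin \o (fun z : 'rV[R]_n =>
    z ord0 i * partial j h (s *: z) - z ord0 j * partial i h (s *: z))).
  exact: (integrableB mS (iI i j) (iI j i)).
move: E2; rewrite (RintegralZl (2 * s) mS iD) (RintegralB mS (iI i j) (iI j i)) => /eqP.
rewrite -mulrA mulf_eq0 pnatr_eq0 /= mulrBr subr_eq0 => /eqP.
exact.
Qed.

End rotation_derivative.

(** * The radial differential equation *)

(** Partial derivatives are computed by formulas that hold only on [D]; openness makes the agreement
    local, so continuity carries over. *)
Lemma continuous_in_open_eq {R : realType} {T : topologicalType} (D : set T) (f g : T -> R) :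
  open D -> {in D, f =1 g} -> {in D, continuous g} -> {in D, continuous f}.
Proof.
move=> oD fg cg x xD; have Dx := set_mem xD.
rewrite /continuous_at (fg x xD); apply: cvg_trans (cg x xD).
apply: near_eq_cvg; apply: filterS (open_nbhs_nbhs (conj oD Dx)) => y Dy.
by rewrite fg// inE.
Qed.

(** Here the coefficient $n-1$ of the radial operator arises: in the double sum the Kronecker symbol
    keeps each [a j] once on the left, while on the right it occurs [n] times. *)
Lemma sum_kronecker_balance {K : comPzRingType} n (s : K) (a : 'I_n -> K) (p q : 'I_n -> 'I_n -> K) :
  (forall i j, s * ((i == j)%:R * a j + s * p i j) = s * (a j + s * q i j)) ->
  s * (s * \sum_j \sum_i p i j) = s * (s * (\sum_j \sum_i q i j) + (n%:R - 1) * \sum_j a j).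
Proof.
move=> key.
have : \sum_i \sum_j (s * ((i == j)%:R * a j + s * p i j)) = \sum_i \sum_j (s * (a j + s * q i j)).
  by apply: eq_bigr => i _; apply: eq_bigr => j _; exact: key.
have -> : \sum_i \sum_j (s * ((i == j)%:R * a j + s * p i j)) =
    s * (\sum_j a j + s * \sum_j \sum_i p i j).
  rewrite exchange_big /= [X in s * X](_ : _ = \sum_j (a j + s * \sum_i p i j)); last first.
    by rewrite big_split /= mulr_sumr.
  rewrite mulr_sumr; apply: eq_bigr => j _.
  rewrite -mulr_sumr big_split /= -mulr_sumr; congr (_ * (_ + _)).
  rewrite (bigD1 j)//= eqxx mul1r big1 ?addr0// => i /negbTE ->.
  by rewrite mul0r.
have -> : \sum_i \sum_j (s * (a j + s * q i j)) = s * (n%:R * \sum_j a j + s * \sum_j \sum_i q i j).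
  rewrite exchange_big /= [X in s * X](_ : _ = \sum_j (n%:R * a j + s * \sum_i q i j)); last first.
    by rewrite big_split /= !mulr_sumr.
  rewrite mulr_sumr; apply: eq_bigr => j _.
  rewrite -mulr_sumr big_split /= -mulr_sumr; congr (_ * (_ + _)).
  by rewrite sumr_const card_ord mulr_natl.
set SI := \sum_j a j; set SL := \sum_j \sum_i q i j; set G := \sum_j \sum_i _.
move=> E; have -> : s * (s * G) = s * (s * SL + (n%:R - 1) * SI) + (s * (SI + s * G) - s * (n%:R * SI + s * SL)) by ring.
by rewrite E subrr addr0.
Qed.

Section coordinates.
Context {R : realType} {n : nat}.

Lemma is_derive_coord (x v : 'rV[R]_n) (i : 'I_n) :
  is_derive x v (fun y : 'rV[R]_n => y ord0 i) (v ord0 i).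
Proof.
have key : h^-1 *: (((fun y : 'rV[R]_n => y ord0 i) \o shift x) (h *: v) - x ord0 i) @[h --> 0^']
    --> v ord0 i.
  apply: cvg_near_cst; near=> h; have h0 : h != 0 by near: h; exact: nbhs_dnbhs_neq.
  by rewrite /= !mxE addrK /GRing.scale /= mulKf.
split; first by apply/cvg_ex; eexists; exact: key.
by apply/cvg_lim => //; exact: key.
Unshelve. all: by end_near. Qed.

Lemma partial_coordM (i k : 'I_n) (f : 'rV[R]_n -> R) x : derivable f x (delta_mx ord0 k) ->
  is_derive x (delta_mx ord0 k) (fun y : 'rV[R]_n => y ord0 i * f y)
    ((i == k)%:R * f x + x ord0 i * partial k f x).
Proof.
move=> df; have := derivableP df => dfP.
have := is_deriveM (is_derive_coord x (delta_mx ord0 k) i) dfP.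
rewrite mxE eqxx /= => h; apply: is_derive_eq.
by rewrite /GRing.scale /= addrC mulrC.
Qed.

Lemma C1_coordM (D : set 'rV[R]_n) (i : 'I_n) (f : 'rV[R]_n -> R) :
  open D -> C1_in D f -> C1_in D (fun y => y ord0 i * f y).
Proof.
move=> oD [cf df cpf]; split.
- by move=> x Dx; apply: continuousM; [exact: continuous_coord|exact: cf].
- by move=> x Dx k; have [] := partial_coordM i (df x Dx k).
- move=> k; apply: (continuous_in_open_eq (g := fun x => (i == k)%:R * f x + x ord0 i * partial k f x)) => //.
    by move=> x /set_mem Dx; have [_] := partial_coordM i (df x Dx k).
  move=> x Dx; apply: (@continuousD _ _ _ (fun x => (i == k)%:R * f x)
      (fun x => x ord0 i * partial k f x)); apply: continuousM.
  + exact: cst_continuous.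
  + exact: cf.
  + exact: continuous_coord.
  + exact: cpf.
Qed.

End coordinates.

Section sphere_ode.
Context {R : realType} {n : nat}.
Hypothesis n_gt0 : (0 < n)%N.
Local Notation sigma := (@sphere_measure R n).
Local Notation S := (@unit_sphere R n).
Local Notation B := (@unit_ball R n).
Implicit Types (w f F : 'rV[R]_n -> R).

Lemma eq_sphere_int w1 w2 f1 f2 (s : R) : `|s| < 1 -> (forall z, S z -> w1 z = w2 z) ->
  (forall x, B x -> f1 x = f2 x) -> sphere_int w1 f1 s = sphere_int w2 f2 s.
Proof.
move=> s1 w12 f12; apply: eq_Rintegral => z /set_mem Sz.
by rewrite w12// f12//; exact: unit_ball_sphere.
Qed.

Lemma sphere_intD w f1 f2 s : `|s| < 1 -> continuous w ->
  {in B, continuous f1} -> {in B, continuous f2} ->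
  sphere_int w (fun x => f1 x + f2 x) s = sphere_int w f1 s + sphere_int w f2 s.
Proof.
move=> s1 cw cf1 cf2.
have mS := @measurable_unit_sphere R n.
rewrite -(RintegralD mS (integrable_sphere_int n_gt0 cw cf1 s1) (integrable_sphere_int n_gt0 cw cf2 s1)).
by apply: eq_Rintegral => z _; rewrite mulrDr.
Qed.

Lemma sphere_int_sum w (f : 'I_n -> 'rV[R]_n -> R) s : `|s| < 1 -> continuous w ->
  (forall j, {in B, continuous (f j)}) ->
  sphere_int w (fun x => \sum_j f j x) s = \sum_j sphere_int w (f j) s.
Proof.
move=> s1 cw cf; have mS := @measurable_unit_sphere R n.
rewrite -(Rintegral_sum _ mS (fun j => integrable_sphere_int n_gt0 cw (cf j) s1)).2.
by apply: eq_Rintegral => z _; rewrite mulr_sumr.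
Qed.

Lemma sphere_intZ c w f s : `|s| < 1 -> continuous w -> {in B, continuous f} ->
  sphere_int w (fun x => c * f x) s = c * sphere_int w f s.
Proof.
move=> s1 cw cf; have mS := @measurable_unit_sphere R n.
rewrite -(RintegralZl c mS (integrable_sphere_int n_gt0 cw cf s1)).
by apply: eq_Rintegral => z _; rewrite mulrCA.
Qed.

Lemma sphere_int_coord w (i : 'I_n) f s : `|s| < 1 -> continuous w ->
  {in B, continuous f} ->
  sphere_int w (fun x => x ord0 i * f x) s = s * sphere_int (fun z => w z * z ord0 i) f s.
Proof.
move=> s1 cw cf; have mS := @measurable_unit_sphere R n.
have cwi : continuous (fun z : 'rV[R]_n => w z * z ord0 i).
  by move=> z; apply: continuousM; [exact: cw|exact: continuous_coord].
rewrite -(RintegralZl s mS (integrable_sphere_int n_gt0 cwi cf s1)).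
by apply: eq_Rintegral => z _; rewrite mxE; ring.
Qed.

Lemma C2_C1 F : C2_in B F -> C1_in B F.
Proof. by move=> [c d p _]; split => // i; have [] := p i. Qed.

Lemma C2_partial_C1 F i : C2_in B F -> C1_in B (partial i F).
Proof. by move=> [_ _ p q]; have [] := p i; split. Qed.

Lemma is_derive_sphere_mean1 F s : C2_in B F -> `|s| < 1 ->
  is_derive s (1 : R) (sphere_int (fun=> 1) F)
    (\sum_j sphere_int (fun z => z ord0 j) (partial j F) s).
Proof.
move=> cF s1.
have c1 : continuous (fun _ : 'rV[R]_n => 1 : R) by move=> z; exact: cst_continuous.
apply: is_derive_eq (is_derive_sphere_int n_gt0 c1 (C2_C1 cF) s1) _.
apply: eq_bigr => j _; apply: eq_sphere_int => // z _; exact: mul1r.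
Qed.

Lemma is_derive_sphere_mean2 F s : C2_in B F -> `|s| < 1 ->
  is_derive s (1 : R) (fun s => \sum_j sphere_int (fun z => z ord0 j) (partial j F) s)
    (\sum_j \sum_k sphere_int (fun z => z ord0 j * z ord0 k) (partial k (partial j F)) s).
Proof.
move=> cF s1.
have := @is_derive_sum _ _ _ n (fun j => sphere_int (fun z => z ord0 j) (partial j F)) s 1.
move=> /(_ _ (fun j => is_derive_sphere_int n_gt0 (@continuous_coord R n j) (C2_partial_C1 j cF) s1)).
rewrite (_ : \sum_(i < n) _ = (fun s => \sum_j sphere_int (fun z => z ord0 j) (partial j F) s)) //.
by apply/funext => t; rewrite fct_sumE.
Qed.

Lemma sphere_ode F s : C2_in B F -> `|s| < 1 ->
  s * (s * sphere_int (fun=> 1) (laplacian F) s) =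
  s * (s * (\sum_j \sum_k sphere_int (fun z => z ord0 j * z ord0 k) (partial k (partial j F)) s) +
    (n%:R - 1) * \sum_j sphere_int (fun z => z ord0 j) (partial j F) s).
Proof.
move=> cF s1.
pose I j := sphere_int (fun z => z ord0 j) (partial j F) s.
pose K i j := sphere_int (fun z => z ord0 i * z ord0 i) (partial j (partial j F)) s.
pose L i j := sphere_int (fun z => z ord0 j * z ord0 i) (partial i (partial j F)) s.
have oB : open B by exact: open_eball.
have cF2 i j : {in B, continuous (partial j (partial i F))} by case: cF.
have cF1 i : {in B, continuous (partial i F)} by case: cF => _ _ /(_ i)[].
have cc2 i j : continuous (fun z : 'rV[R]_n => z ord0 i * z ord0 j).
  by move=> z; apply: continuousM; exact: continuous_coord.
(* Rotation invariance in the plane $(i,j)$ applied to $y_i\partial_jF$; the Kronecker symbol comes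
   from differentiating the factor $y_i$. For $i=j$ both sides coincide. *)
have key i j : s * ((i == j)%:R * I j + s * K i j) = s * (I j + s * L i j).
  have C1h := C1_coordM i oB (C2_partial_C1 j cF).
  have E k l : sphere_int (fun z => z ord0 l) (partial k (fun y => y ord0 i * partial j F y)) s =
      (i == k)%:R * sphere_int (fun z => z ord0 l) (partial j F) s +
      s * sphere_int (fun z => z ord0 l * z ord0 i) (partial k (partial j F)) s.
    rewrite -sphere_int_coord//; last exact: continuous_coord.
    rewrite -sphere_intZ//; last exact: continuous_coord.
    rewrite -sphere_intD//.
    - apply: eq_sphere_int => // x Bx.
      have [_ _ /(_ j)[_ /(_ x Bx k) d] _] := cF.
      by have [_] := partial_coordM i d.
    - exact: continuous_coord.
    - by move=> x Bx; apply: (@continuousM _ _ (fun=> (i == k)%:R) (partial j F)); [exact: cst_continuous|exact: cF1].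
    - by move=> x Bx; apply: (@continuousM _ _ (fun y : 'rV[R]_n => y ord0 i) (partial k (partial j F))); [exact: continuous_coord|exact: cF2].
  have [<-|ij] := eqVneq i j.
    rewrite mul1r; congr (_ * (_ + _ * _)).
  have := sphere_int_rot ij C1h s1; rewrite !E eqxx (negbTE ij) !mul0r !add0r mul1r.
  by rewrite /K /L.
(* The weights $z_i^2$ add up to $1$ on the unit sphere. *)
have EK : \sum_j \sum_i K i j = sphere_int (fun=> 1) (laplacian F) s.
  rewrite /laplacian sphere_int_sum//; last by move=> z; exact: cst_continuous.
  apply: eq_bigr => j _; have mS := @measurable_unit_sphere R n.
  rewrite -(Rintegral_sum _ mS (fun i => integrable_sphere_int n_gt0 (cc2 i i) (cF2 j j) s1)).2.
  apply: eq_Rintegral => z /set_mem Sz; rewrite -mulr_suml; congr (_ * _).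
  by rewrite -[RHS](expr1n _ 2) -Sz enorm_sqr; apply: eq_bigr => i _; rewrite expr2.
have H := @sum_kronecker_balance _ n s I K L key.
rewrite -EK.
exact: H.
Qed.

End sphere_ode.

(** * Powers of absolute values *)

Section abs_power.
Context {R : realType}.
Implicit Types q t : R.

Lemma norm_powR2 t : `|t| `^ 2 = t ^+ 2.
Proof. by rewrite powR_mulrn// real_normK// num_real. Qed.

Lemma norm_powRE q t : `|t| `^ q = (t ^+ 2) `^ (q / 2).
Proof. by rewrite -norm_powR2 -powRrM mulrCA divff// mulr1. Qed.

(** Writing $|t|^q=(t^2)^{q/2}$ removes the absolute value: away from the origin the base is a
    positive smooth function. *)
Lemma is_derive_norm_powR_neq0 q t : t != 0 ->
  is_derive t (1 : R) (fun t => `|t| `^ q) (q * (`|t| `^ (q - 2) * t)).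
Proof.
move=> t0; have t2 : 0 < t ^+ 2 by rewrite exprn_even_gt0.
rewrite (_ : (fun _ => _) = (fun x : R => x `^ (q / 2)) \o (fun t : R => t ^+ 2)); last first.
  by apply/funext => y; rewrite /= norm_powRE.
have d1 : is_derive t (1 : R) (fun t : R => t ^+ 2) (2 * t).
  by apply: is_derive_eq; rewrite /GRing.scale /=; ring.
have d2 := is_derive1_powR (q / 2) t2.
have := @is_derive1_comp R (fun x : R => x `^ (q / 2)) (fun x : R => x ^+ 2) t _ _ d2 d1 => h; apply: is_derive_eq.
rewrite norm_powRE (_ : (q - 2) / 2 = q / 2 - 1); last by field.
by rewrite /GRing.scale /=; field.
Qed.

Lemma continuous_norm_powR q : 0 <= q -> continuous (fun t => `|t| `^ q).
Proof.
rewrite le_eqVlt => /predU1P[<-|q0] t.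
  rewrite (_ : (fun _ => _) = fun=> 1); first exact: cst_continuous.
  by apply/funext => x; rewrite powRr0.
have [->|t0] := eqVneq t 0; last first.
  have [d _] := is_derive_norm_powR_neq0 q t0.
  by apply: differentiable_continuous; apply/derivable1_diffP.
rewrite /continuous_at normr0 powR0 ?gt_eqF//.
apply/(@cvgrPdist_lt _ _ _ (nbhs (0 : R)) (nbhs_filter (0 : R))) => e e0.
near=> x; rewrite sub0r normrN ger0_norm ?powR_ge0//.
rewrite -[ltRHS](@powRr1 _ e) ?ltW// -(@mulVf _ q) ?gt_eqF// powRrM.
rewrite gt0_ltr_powR ?nnegrE ?powR_ge0//.
near: x. exact: (@nbhs0_lt R R _ (powR_gt0 _ e0)).
Unshelve. all: by end_near. Qed.

Lemma norm_powR_sqr q t : 0 <= q -> `|t| `^ q * t ^+ 2 = `|t| `^ (q + 2).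
Proof. by move=> q0; rewrite powRD ?norm_powR2// gt_eqF// ltr_wpDl. Qed.

Lemma is_derive_norm_powR q t : 2 <= q ->
  is_derive t (1 : R) (fun t => `|t| `^ q) (q * (`|t| `^ (q - 2) * t)).
Proof.
move=> q2; have [->|t0] := eqVneq t 0; last exact: is_derive_norm_powR_neq0.
have q20 : 0 <= q - 2 by rewrite subr_ge0.
have key : h^-1 *: (((fun t : R => `|t| `^ q) \o shift (0 : R)) (h *: (1 : R)) - `|(0 : R)| `^ q) @[h --> 0^'] -->
    q * (`|(0 : R)| `^ (q - 2) * 0).
  (* At the origin the difference quotient is $|h|^{q-2}h$, so the derivative formula, continuous at
     $0$, supplies its own limit; this includes $q=2$. *)
  have cc : {for (0 : R), continuous (fun t : R => `|t| `^ (q - 2) * t)}.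
    by apply: continuousM; [exact: continuous_norm_powR|exact: cvg_id].
  have c := (continuous_withinNx _ _).1 cc.
  rewrite !mulr0 in c *; apply: (cvg_trans _ c); apply: near_eq_cvg; near=> h.
  have h0 : h != 0 by near: h; exact: nbhs_dnbhs_neq.
  rewrite /= scaler1 addr0 normr0 powR0 ?gt_eqF//; last lra.
  rewrite subr0 -[X in _ = _ *: (_ `^ X)](subrK 2 q) -norm_powR_sqr//.
  by rewrite /GRing.scale /=; field.
split; first by apply/cvg_ex; eexists; exact: key.
by apply/cvg_lim => //; exact: key.
Unshelve. all: by end_near. Qed.

Lemma is_derive_norm_powRM q t : 0 <= q ->
  is_derive t (1 : R) (fun t => `|t| `^ q * t) ((q + 1) * `|t| `^ q).
Proof.
move=> q0; have [->|t0] := eqVneq t 0; last first.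
  have := is_derive_norm_powR_neq0 q t0 => h.
  apply: is_derive_eq; rewrite /GRing.scale /= mulr1.
  have E : `|t| `^ q = `|t| `^ (q - 2) * t ^+ 2.
    by rewrite -norm_powR2 -powRD ?subrK// normr_eq0 t0 implybT.
  by rewrite E; ring.
have key : h^-1 *: (((fun t : R => `|t| `^ q * t) \o shift (0 : R)) (h *: (1 : R)) - `|(0 : R)| `^ q * 0) @[h --> 0^'] -->
    (q + 1) * `|(0 : R)| `^ q.
  (* The difference quotient at $0$ is $|h|^q$, without the factor $q+1$. The two limits agree:
     either $q=0$ and the factor is $1$, or $|0|^q=0$. *)
  have -> : (q + 1) * `|(0 : R)| `^ q = `|(0 : R)| `^ q.
    have [->|qn0] := eqVneq q 0; first by rewrite add0r mul1r.
    by rewrite normr0 powR0// mulr0.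
  have cc : {for (0 : R), continuous (fun t : R => `|t| `^ q)} by exact: continuous_norm_powR.
  have c := (continuous_withinNx _ _).1 cc.
  apply: (cvg_trans _ c); apply: near_eq_cvg; near=> h.
  have h0 : h != 0 by near: h; exact: nbhs_dnbhs_neq.
  rewrite /= scaler1 addr0 mulr0 subr0 /GRing.scale /=.
  by field.
split; first by apply/cvg_ex; eexists; exact: key.
by apply/cvg_lim => //; exact: key.
Unshelve. all: by end_near. Qed.

End abs_power.

Section directional_chain_rule.
Context {R : realType} {n : nat}.
Implicit Types (f g : 'rV[R]_n -> R) (x v : 'rV[R]_n) (D : set 'rV[R]_n).

(** Restriction to the line through [x] in direction [v], so that directional chain rules reduce to
    the one-variable ones. *)
Lemma is_derive_dirP f x v d :
  is_derive x v f d <-> is_derive (0 : R) (1 : R) (fun s => f (x + s *: v)) d.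
Proof.
have E : (fun h : R => h^-1 *: (((fun s => f (x + s *: v)) \o shift (0 : R)) (h *: (1 : R)) -
      f (x + (0 : R) *: v))) =
   (fun h : R => h^-1 *: ((f \o shift x) (h *: v) - f x)).
  apply/funext => h /=; rewrite scale0r !addr0; congr (_ *: (f _ - _)).
  by rewrite scaler1 addrC.
by split=> -[d1 d2]; split; move: d1 d2; rewrite /derivable /derive E.
Qed.

Lemma is_derive_comp_dir (p : R -> R) dp f x v df :
  is_derive (f x) (1 : R) p dp -> is_derive x v f df ->
  is_derive x v (fun y => p (f y)) (dp * df).
Proof.
move=> hp /is_derive_dirP hf; apply/is_derive_dirP.
apply: (@is_derive1_comp R p (fun s => f (x + s *: v)) 0 _ _ _ hf).
by rewrite scale0r addr0.
Qed.

Lemma is_derive_in_open_eq D f g x v d : open D -> {in D, f =1 g} -> D x ->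
  is_derive x v g d -> is_derive x v f d.
Proof.
move=> oD fg Dx; apply: near_eq_is_derive.
apply: filterS (open_nbhs_nbhs (conj oD Dx)) => y Dy.
by rewrite fg// inE.
Qed.

End directional_chain_rule.

Section abs_power_C2.
Context {R : realType} {n : nat}.
Variables (D : set 'rV[R]_n) (u : 'rV[R]_n -> R) (nu : R).
Hypotheses (oD : open D) (cu : C2_in D u) (nu2 : 2 <= nu).

Let q0 : 0 <= nu - 2. Proof. by rewrite subr_ge0. Qed.

Let F x := `|u x| `^ nu.
(** Up to the factor [nu], the derivative of $|t|^\nu$ evaluated at [u]. It is differentiated as a
    whole, since $|t|^{\nu-2}$ alone need not be differentiable at $0$. *)
Let P x := `|u x| `^ (nu - 2) * u x.

Let du x i : D x -> is_derive x (delta_mx ord0 i) u (partial i u x).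
Proof. by case: cu => _ d _ _ Dx; apply: derivableP; exact: d. Qed.

Let dF x i : D x -> is_derive x (delta_mx ord0 i) F (nu * P x * partial i u x).
Proof.
move=> Dx; have := is_derive_comp_dir (is_derive_norm_powR (u x) nu2) (du i Dx).
exact.
Qed.

Let dP x i : D x -> is_derive x (delta_mx ord0 i) P ((nu - 1) * `|u x| `^ (nu - 2) * partial i u x).
Proof.
move=> Dx; have := is_derive_comp_dir (is_derive_norm_powRM (u x) q0) (du i Dx).
by rewrite (_ : nu - 2 + 1 = nu - 1); last ring.
Qed.

Let partialF x i : x \in D -> partial i F x = nu * (P x * partial i u x).
Proof. by move=> /set_mem Dx; have [_] := dF i Dx; rewrite mulrA. Qed.

Let ddF x i j : D x -> is_derive x (delta_mx ord0 j) (partial i F)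
  (nu * (nu - 1) * `|u x| `^ (nu - 2) * (partial j u x * partial i u x)
   + nu * (P x * partial j (partial i u) x)).
Proof.
move=> Dx; apply: (is_derive_in_open_eq oD (fun y Dy => partialF i Dy) Dx).
have dui : is_derive x (delta_mx ord0 j) (partial i u) (partial j (partial i u) x).
  by case: cu => _ _ /(_ i)[_ d] _; apply: derivableP; exact: d.
have := is_deriveZ nu (is_deriveM (dP j Dx) dui) => h.
by apply: is_derive_eq; rewrite /GRing.scale /=; ring.
Qed.

Let cu0 : {in D, continuous u}. Proof. by case: cu. Qed.

Let cP : {in D, continuous P}.
Proof.
move=> x Dx; apply: (@continuousM _ _ (fun x => `|u x| `^ (nu - 2)) u); last exact: cu0.
apply: (@continuous_comp _ _ _ u (fun t => `|t| `^ (nu - 2))); first exact: cu0.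
exact: continuous_norm_powR.
Qed.

Let cQ : {in D, continuous (fun x => `|u x| `^ (nu - 2))}.
Proof.
move=> x Dx.
apply: (@continuous_comp _ _ _ u (fun t => `|t| `^ (nu - 2))); first exact: cu0.
exact: continuous_norm_powR.
Qed.

Let cu1 i : {in D, continuous (partial i u)}. Proof. by case: cu => _ _ /(_ i)[]. Qed.

Let cu2 i j : {in D, continuous (partial j (partial i u))}. Proof. by case: cu. Qed.

Lemma C2_norm_powR : C2_in D F.
Proof.
split.
- move=> x Dx; apply: (@continuous_comp _ _ _ u (fun t => `|t| `^ nu)); first exact: cu0.
  by apply: continuous_norm_powR; rewrite (le_trans _ nu2).
- by move=> x Dx i; have [] := dF i Dx.
- move=> i; split; last by move=> x Dx j; have [] := ddF i j Dx.
  apply: (continuous_in_open_eq oD (fun x Dx => partialF i Dx)) => x Dx.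
  apply: (@continuousM _ _ (fun=> nu) (fun x => P x * partial i u x)).
    exact: cst_continuous.
  by apply: (@continuousM _ _ P (partial i u)); [exact: cP|exact: cu1].
- move=> i j.
  have E : {in D, partial j (partial i F) =1 fun x =>
    nu * (nu - 1) * `|u x| `^ (nu - 2) * (partial j u x * partial i u x)
     + nu * (P x * partial j (partial i u) x)}.
    by move=> x /set_mem Dx; have [_] := ddF i j Dx.
  apply: (continuous_in_open_eq oD E) => x Dx.
  apply: (@continuousD _ _ _ (fun x => nu * (nu - 1) * `|u x| `^ (nu - 2) * (partial j u x * partial i u x))
     (fun x => nu * (P x * partial j (partial i u) x))).
    apply: (@continuousM _ _ (fun x => nu * (nu - 1) * `|u x| `^ (nu - 2)) (fun x => partial j u x * partial i u x)).
      apply: (@continuousM _ _ (fun=> nu * (nu - 1)) (fun x => `|u x| `^ (nu - 2))).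
        exact: cst_continuous.
      exact: cQ.
    by apply: (@continuousM _ _ (partial j u) (partial i u)); exact: cu1.
  apply: (@continuousM _ _ (fun=> nu) (fun x => P x * partial j (partial i u) x)).
    exact: cst_continuous.
  by apply: (@continuousM _ _ P (partial j (partial i u))); [exact: cP|exact: cu2].
Qed.

Lemma laplacian_norm_powR x : D x -> laplacian (fun y => `|u y| `^ nu) x =
  nu * (nu - 1) * (`|u x| `^ (nu - 2) * enorm (gradient u x) ^+ 2)
  + nu * (`|u x| `^ (nu - 2) * u x * laplacian u x).
Proof.
move=> Dx; rewrite /laplacian enorm_sqr !mulr_sumr -big_split /=.
apply: eq_bigr => i _.
have [_] := ddF i i Dx; rewrite -/(partial i (partial i F) x) => ->.
by rewrite /P !mxE; ring.
Qed.

End abs_power_C2.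

(** * Hoelder inequality *)

Lemma eq_ler {R : numDomainType} (x y : R) : x = y -> x <= y.
Proof. by move=> ->. Qed.

Lemma powRV {R : realType} (a r : R) : 0 <= a -> a^-1 `^ r = (a `^ r)^-1.
Proof. by move=> a0; rewrite -powR_inv1// -powRrM mulN1r powRN. Qed.

Section young.
Context {R : realType}.
Implicit Types x y p q nu : R.

(** Weighted arithmetic-geometric mean inequality for [X], [Y] and $1$: the logarithm lies below its
    tangent at the weighted mean [S], and the three tangent inequalities are averaged. *)
Let young3_gt0 (X Y a b c : R) : 0 < X -> 0 < Y -> 0 <= a -> 0 <= b -> 0 <= c -> a + b + c = 1 ->
  X `^ a * Y `^ b <= a * X + b * Y + c.
Proof.
move=> X0 Y0 a0 b0 c0 abc; pose S := a * X + b * Y + c.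
have S0 : 0 < S.
  rewrite lt_neqAle; apply/andP; split; last by rewrite !addr_ge0// mulr_ge0// ltW.
  apply/eqP => S0.
  have aX : 0 <= a * X by rewrite mulr_ge0// ltW.
  have bY : 0 <= b * Y by rewrite mulr_ge0// ltW.
  have /eqP : a * X = 0 by rewrite /S in S0; lra.
  have /eqP : b * Y = 0 by rewrite /S in S0; lra.
  rewrite !mulf_eq0 (gt_eqF X0) (gt_eqF Y0) !orbF => /eqP b00 /eqP a00.
  by rewrite /S in S0; lra.
have tangent z : 0 < z -> 1 + ln z - ln S <= z / S.
  move=> z0; rewrite -addrA -ln_div ?posrE// -[leRHS](@lnK _ (z / S)) ?posrE ?divr_gt0//.
  exact: expR_ge1Dx.
have tX := tangent X X0; have tY := tangent Y Y0; have t1 := tangent 1 ltr01.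
rewrite ln1 in t1.
have Ssum : a * (X / S) + b * (Y / S) + c * (1 / S) = 1.
  by rewrite !mulrA -!mulrDl mulr1 divff// gt_eqF.
have key : a * ln X + b * ln Y <= ln S.
  have := ler_wpM2l a0 tX; have := ler_wpM2l b0 tY; have := ler_wpM2l c0 t1.
  move: Ssum; set x1 := X / S; set y1 := Y / S; set z1 := 1 / S => E h1 h2 h3.
  have : a * (1 + ln X - ln S) + b * (1 + ln Y - ln S) + c * (1 + 0 - ln S) <= 1 by lra.
  rewrite (_ : _ + _ + _ = (a + b + c) + (a * ln X + b * ln Y) - (a + b + c) * ln S); last ring.
  by rewrite abc; lra.
rewrite -/S -[leRHS](@lnK _ S) ?posrE// /powR !gt_eqF// -expRD.
by rewrite ler_expR.
Qed.

(** The third weight, carried by the constant $1$, absorbs the slack $\nu-(p+q)$; on a probability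
    space it integrates to itself. *)
Lemma young3 x y p q nu : 0 <= x -> 0 <= y -> 0 <= p -> 0 <= q -> 0 < nu -> p + q <= nu ->
  x `^ p * y `^ q <= p / nu * x `^ nu + q / nu * y `^ nu + (1 - (p + q) / nu).
Proof.
move=> x0 y0 p0 q0 nu0 pq.
have c0 : 0 <= 1 - (p + q) / nu by rewrite subr_ge0 ler_pdivrMr// mul1r.
have rhs0 z w : 0 <= p / nu * z `^ nu + q / nu * w `^ nu + (1 - (p + q) / nu).
  apply: addr_ge0 => //.
  by apply: addr_ge0; rewrite mulr_ge0 ?powR_ge0// divr_ge0// ltW.
wlog : x x0 / 0 < x => [hw|{x0} x0].
  move: x0; rewrite le_eqVlt => /predU1P[<-|x0]; last by apply: hw => //; rewrite ltW.
  (* Since $0^0=1$, the case $x=0$, $p=0$ is not trivial, but then neither side depends on [x], and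
     $x=1$ may be taken. *)
  have [p00|pn0] := eqVneq p 0; last by rewrite powR0// mul0r.
  by have := hw 1 ler01 ltr01; rewrite p00 !powRr0 !mul0r.
wlog : y y0 / 0 < y => [hw|{y0} y0].
  move: y0; rewrite le_eqVlt => /predU1P[<-|y0]; last by apply: hw => //; rewrite ltW.
  have [q00|qn0] := eqVneq q 0; last by rewrite powR0// mulr0.
  by have := hw 1 ler01 ltr01; rewrite q00 !powRr0 !mul0r.
have -> : x `^ p = (x `^ nu) `^ (p / nu) by rewrite -powRrM mulrC divfK ?gt_eqF.
have -> : y `^ q = (y `^ nu) `^ (q / nu) by rewrite -powRrM mulrC divfK ?gt_eqF.
have nuge0 := ltW nu0.
apply: young3_gt0 => //; rewrite ?powR_gt0 ?divr_ge0//.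
by field; rewrite gt_eqF.
Qed.

End young.

Section holder.
Context {d} {T : measurableType d} {R : realType}.
Variables (mu : {measure set T -> \bar R}) (D : set T).
Hypotheses (mD : measurable D) (muD : mu D = 1%E).
Implicit Types (f g : T -> R) (a b p q nu : R).

(** Young's inequality is applied to $f/a$ and $g/b$ and integrated. The bounds [a] and [b] are only
    required to dominate the norms, and total mass $1$ turns $p+q\le\nu$ into an admissible
    range. *)
Let holder_gt0 f g a b p q nu : (forall x, D x -> 0 <= f x) -> (forall x, D x -> 0 <= g x) ->
  0 <= p -> 0 <= q -> 0 < nu -> p + q <= nu -> 0 < a -> 0 < b ->
  mu.-integrable D (EFin \o (fun x => f x `^ nu)) ->
  mu.-integrable D (EFin \o (fun x => g x `^ nu)) ->
  mu.-integrable D (EFin \o (fun x => f x `^ p * g x `^ q)) ->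
  \int[mu]_(x in D) (f x `^ nu) <= a `^ nu ->
  \int[mu]_(x in D) (g x `^ nu) <= b `^ nu ->
  \int[mu]_(x in D) (f x `^ p * g x `^ q) <= a `^ p * b `^ q.
Proof.
move=> f0 g0 p0 q0 nu0 pq a0 b0 intf intg intfg fa gb.
pose A := a `^ p * b `^ q.
have A0 : 0 < A by rewrite mulr_gt0// powR_gt0.
pose c1 := A * (p / nu) / a `^ nu; pose c2 := A * (q / nu) / b `^ nu.
pose c3 := A * (1 - (p + q) / nu).
have c10 : 0 <= c1.
  by rewrite /c1 !mulr_ge0 ?invr_ge0 ?powR_ge0// ltW.
have c20 : 0 <= c2.
  by rewrite /c2 !mulr_ge0 ?invr_ge0 ?powR_ge0// ltW.
have i1 : mu.-integrable D (EFin \o (fun x => c1 * f x `^ nu)) by exact: (integrableZl mD c1 intf).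
have i2 : mu.-integrable D (EFin \o (fun x => c2 * g x `^ nu)) by exact: (integrableZl mD c2 intg).
have i12 : mu.-integrable D (EFin \o (fun x => c1 * f x `^ nu + c2 * g x `^ nu)).
  exact: (integrableD mD i1 i2).
have i3 : mu.-integrable D (EFin \o (fun=> c3)).
  apply: measurable_bounded_integrable => //; last exact: bounded_cst.
  by rewrite muD ltry.
have i123 : mu.-integrable D (EFin \o (fun x => c1 * f x `^ nu + c2 * g x `^ nu + c3)).
  exact: (integrableD mD i12 i3).
have pw x : D x -> f x `^ p * g x `^ q <= c1 * f x `^ nu + c2 * g x `^ nu + c3.
  move=> Dx.
  have fx := f0 x Dx; have gx := g0 x Dx.
  have := @young3 R (f x / a) (g x / b) p q nu.
  have age0 := ltW a0; have bge0 := ltW b0.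
  rewrite !divr_ge0// => /(_ isT isT p0 q0 nu0 pq).
  rewrite !powRM ?invr_ge0// !powRV//.
  rewrite -(ler_pM2l A0) /c1 /c2 /c3.
  have ap : a `^ p != 0 by rewrite gt_eqF ?powR_gt0.
  have bq : b `^ q != 0 by rewrite gt_eqF ?powR_gt0.
  have an : a `^ nu != 0 by rewrite gt_eqF ?powR_gt0.
  have bn : b `^ nu != 0 by rewrite gt_eqF ?powR_gt0.
  have nun : nu != 0 by rewrite gt_eqF.
  rewrite [leLHS](_ : _ = f x `^ p * g x `^ q); last by rewrite /A; field; rewrite ap bq.
  by move=> h; apply: (le_trans h); apply/eq_ler; ring.
apply: (le_trans (le_Rintegral mD intfg i123 pw)).
rewrite (RintegralD mD i12 i3) (RintegralD mD i1 i2) (RintegralZl _ mD intf) (RintegralZl _ mD intg).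
rewrite Rintegral_cst// muD mulr1.
apply: (@le_trans _ _ (c1 * a `^ nu + c2 * b `^ nu + c3)).
  by rewrite lerD2r lerD// ler_wpM2l.
rewrite /c1 /c2 /c3 !divfK ?gt_eqF ?powR_gt0// -/A.
by apply/eq_ler; field; rewrite gt_eqF.
Qed.

Lemma holder_powR f g a b p q nu : (forall x, D x -> 0 <= f x) -> (forall x, D x -> 0 <= g x) ->
  0 <= p -> 0 <= q -> 0 < nu -> p + q <= nu -> 0 < a -> 0 <= b ->
  mu.-integrable D (EFin \o (fun x => f x `^ nu)) ->
  mu.-integrable D (EFin \o (fun x => g x `^ nu)) ->
  mu.-integrable D (EFin \o (fun x => f x `^ p * g x `^ q)) ->
  \int[mu]_(x in D) (f x `^ nu) <= a `^ nu ->
  \int[mu]_(x in D) (g x `^ nu) <= b `^ nu ->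
  \int[mu]_(x in D) (f x `^ p * g x `^ q) <= a `^ p * b `^ q.
Proof.
move=> f0 g0 p0 q0 nu0 pq a0 + intf intg intfg fa.
rewrite le_eqVlt => /predU1P[<-|b0] gb; last exact: (@holder_gt0 f g a b p q nu).
have h e : 0 < e -> \int[mu]_(x in D) (f x `^ p * g x `^ q) <= a `^ p * e `^ q.
  move=> e0; apply: (@holder_gt0 f g a e p q nu) => //.
  by rewrite (le_trans gb)// powR0 ?gt_eqF// powR_ge0.
have [q00|qn0] := eqVneq q 0; first by have := h 1 ltr01; rewrite q00 !powRr0.
rewrite powR0// mulr0; apply/ler_addgt0Pr => e e0; rewrite add0r.
have ap : 0 < a `^ p by rewrite powR_gt0.
(* Chosen so that the resulting bound $a^p(\cdot)^q$ is exactly [e]: the case $b=0$ is the limit of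
   positive bounds. *)
have := h ((e / a `^ p) `^ q^-1); rewrite powR_gt0 ?divr_gt0// => /(_ isT).
by rewrite -powRrM mulVf// (powRr1 (divr_ge0 (ltW e0) (ltW ap))) mulrC divfK// gt_eqF.
Qed.

End holder.

(** * Comparison for the radial operator *)

Section comparison.
Context {R : realType}.
Implicit Types (t : R) (f : R -> R).

Lemma is_derive_continuous f t df : is_derive t (1 : R) f df -> {for t, continuous f}.
Proof. by case=> d _; apply: differentiable_continuous; apply/derivable1_diffP. Qed.

(* If [k] is the Green kernel of the operator [h'' + (N / t) h'], then
   [k h' + h] is a primitive of [k (h'' + (N / t) h')]. *)
Lemma radial_comparison (N : R) (k h h1 h2 E dE : R -> R) :
  {within `[0, 1], continuous k} -> k 0 = 0 -> k 1 = 0 ->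
  (forall t, t \in `]0, 1[ -> is_derive t (1 : R) k (N * k t / t - 1)) ->
  (forall t, t \in `[0, 1] -> is_derive t (1 : R) h (h1 t)) ->
  (forall t, t \in `[0, 1] -> is_derive t (1 : R) h1 (h2 t)) ->
  {within `[0, 1], continuous E} ->
  (forall t, t \in `]0, 1[ -> is_derive t (1 : R) E (dE t)) ->
  (forall t, t \in `]0, 1[ -> k t * (h2 t + N * h1 t / t) <= dE t) ->
  h 1 - h 0 <= E 1 - E 0.
Proof.
move=> ck k0 k1 dk dh dh1 cE dEt le.
pose Q t := k t * h1 t + h t - E t.
pose dQ t := k t * (h2 t + N * h1 t / t) - dE t.
have within f df : (forall t, t \in `[0, 1] -> is_derive t (1 : R) f (df t)) ->
    {within `[0, 1], continuous f}.
  move=> df'; apply: continuous_in_subspaceT => t /set_mem t01.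
  exact: is_derive_continuous (df' t t01).
have cQ : {within `[0, 1], continuous Q}.
  move=> t; apply: cvgB; last exact: cE.
  apply: cvgD; last exact: (within _ _ dh t).
  by apply: cvgM; [exact: ck|exact: (within _ _ dh1 t)].
have dQt t : t \in `]0, 1[ -> is_derive t (1 : R) Q (dQ t).
  move=> t01; have t01' := subset_itv_oo_cc t01.
  have i1 := dk t t01; have i2 := dh1 t t01'; have i3 := dh t t01'; have i4 := dEt t t01.
  have t0 : t != 0 by move: t01; rewrite in_itv/= => /andP[t0 _]; rewrite gt_eqF.
  by apply: is_derive_eq; rewrite /GRing.scale /= /dQ; field.
have [c c01 cE'] := MVT (@ltr01 R) dQt cQ.
have : Q 1 - Q 0 <= 0 by rewrite cE' subr0 mulr1 subr_le0; exact: le.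
rewrite /Q k0 k1 !mul0r !add0r; lra.
Qed.

Let mu := @lebesgue_measure R.

Lemma integrable_itv01 f : {in `[0, 1], continuous f} ->
  mu.-integrable `[0, 1] (EFin \o f).
Proof.
move=> cf; apply: continuous_compact_integrable; first exact: segment_compact.
by apply: continuous_in_subspaceT => t /set_mem; exact: cf.
Qed.

Definition primitive f t := \int[mu]_(x in `[0, t]) f x.

Lemma primitive0 f : primitive f 0 = 0.
Proof. by rewrite /primitive set_itv1 Rintegral_set1. Qed.

Lemma continuous_primitive f : {in `[0, 1], continuous f} ->
  {within `[0, 1], continuous (primitive f)}.
Proof.
by move=> cf; apply: parameterized_integral_continuous; [exact: ler01|exact: integrable_itv01].
Qed.

Lemma is_derive_primitive f t : {in `[0, 1], continuous f} -> t \in `]0, 1[ ->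
  is_derive t (1 : R) (primitive f) (f t).
Proof.
move=> cf t01; have := t01; rewrite in_itv/= => /andP[t0 t1].
have [d1 d2] := continuous_FTC1 t1 (integrable_itv01 cf) t0 (cf t (subset_itv_oo_cc t01)).
by split => //; rewrite -derive1E.
Qed.

End comparison.

(** * Spherical means of C2 functions *)

Lemma is_derive_ge0_le {R : realType} (f df : R -> R) (a b : R) : a <= b ->
  (forall t, t \in `[a, b] -> is_derive t (1 : R) f (df t)) ->
  (forall t, t \in `]a, b[ -> 0 <= df t) -> f a <= f b.
Proof.
rewrite le_eqVlt => /predU1P[->//|ab] fdf df0.
have cf : {within `[a, b], continuous f}.
  apply: continuous_in_subspaceT => t /set_mem tab.
  exact: is_derive_continuous (fdf t tab).
have [c cab E] := MVT ab (fun t tab => fdf t (subset_itv_oo_cc tab)) cf.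
by rewrite -subr_ge0 E mulr_ge0 ?df0// subr_ge0 ltW.
Qed.

Lemma is_derive_exprn {R : realType} m (t : R) :
  is_derive t (1 : R) (fun t => t ^+ m) (m%:R * t ^+ m.-1).
Proof.
by split; [exact: exprn_derivable|rewrite exp_derive /GRing.scale /= mulr1].
Qed.

Section spherical_means.
Context {R : realType} {n : nat}.
Hypothesis n2 : (2 <= n)%N.
Local Notation S := (@unit_sphere R n).
Local Notation B := (@unit_ball R n).
Implicit Types (f F u : 'rV[R]_n -> R) (s t : R).

Let n_gt0 : (0 < n)%N. Proof. exact: ltnW. Qed.

Let c1 : continuous (fun _ : 'rV[R]_n => 1 : R).
Proof. by move=> z; exact: cst_continuous. Qed.

Definition sphere_avg f s := sphere_int (fun=> 1) f s.

Lemma ler_sphere_avg f1 f2 s : `|s| < 1 -> {in B, continuous f1} -> {in B, continuous f2} ->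
  (forall x, B x -> f1 x <= f2 x) -> sphere_avg f1 s <= sphere_avg f2 s.
Proof.
move=> s1 cf1 cf2 f12; have mS := @measurable_unit_sphere R n.
apply: (le_Rintegral mS (integrable_sphere_int n_gt0 c1 cf1 s1) (integrable_sphere_int n_gt0 c1 cf2 s1)).
by move=> z Sz; rewrite !mul1r; apply/f12/unit_ball_sphere.
Qed.

Lemma sphere_avg_cst c s : sphere_avg (fun=> c) s = c.
Proof.
have mS := @measurable_unit_sphere R n.
rewrite /sphere_avg /sphere_int (@eq_Rintegral _ _ _ _ _ (cst c)); last by move=> z _; rewrite mul1r.
have h : @sphere_measure R n S = 1%E by exact: sphere_measure_sphere.
rewrite (Rintegral_cst _ mS) -[X in fine X]/(sphere_measure S) h /=.
exact: mulr1.
Qed.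

Lemma sphere_avg0 f : sphere_avg f 0 = f 0.
Proof.
rewrite -[RHS](sphere_avg_cst (f 0) 0); apply: eq_Rintegral => z _.
by rewrite scale0r.
Qed.

Lemma continuous_laplacian F : C2_in B F -> {in B, continuous (laplacian F)}.
Proof.
by move=> [_ _ _ c] x Bx; apply: continuous_sumr => i _; exact: c.
Qed.

Section green.
Variable F : 'rV[R]_n -> R.
Hypothesis cF : C2_in B F.

(** The derivatives are hidden behind existential quantifiers because only the equation relating
    them matters from here on. *)
Lemma sphere_avg_ode : exists g1 g2 : R -> R, forall s, `|s| < 1 ->
  [/\ is_derive s (1 : R) (sphere_avg F) (g1 s), is_derive s (1 : R) g1 (g2 s) &
      s * (s * sphere_avg (laplacian F) s) = s * (s * g2 s + (n%:R - 1) * g1 s)].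
Proof.
exists (fun s => \sum_j sphere_int (fun z => z ord0 j) (partial j F) s).
exists (fun s => \sum_j \sum_k sphere_int (fun z => z ord0 j * z ord0 k) (partial k (partial j F)) s).
move=> s s1; split.
- exact: is_derive_sphere_mean1.
- exact: is_derive_sphere_mean2.
- exact: sphere_ode.
Qed.

Lemma sphere_avg_nondecreasing s t : 0 <= s <= t -> t < 1 ->
  (forall x, B x -> 0 <= laplacian F x) -> sphere_avg F s <= sphere_avg F t.
Proof.
move=> /andP[s0 st] t1 lapF; have [g1 [g2 gP]] := sphere_avg_ode.
have avg0 p : `|p| < 1 -> 0 <= sphere_avg (laplacian F) p.
  move=> p1; rewrite -(sphere_avg_cst 0 p); apply: ler_sphere_avg => //.
    by move=> x _; exact: cst_continuous.
  exact: continuous_laplacian.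
have abs1 p : 0 <= p <= t -> `|p| < 1.
  by move=> /andP[p0 pt]; rewrite ger0_norm// (le_lt_trans pt).
have g10 p : 0 < p <= t -> 0 <= g1 p.
  move=> /andP[p0 pt].
  (* The integrating factor $q^{n-1}$ makes the radial operator exact: $W'=q^{n-1}$ times the mean
     of $\Delta F$, and $W(0)=0$ because $n\ge2$. *)
  pose W q := q ^+ n.-1 * g1 q.
  pose dW q := n.-1%:R * q ^+ n.-2 * g1 q + q ^+ n.-1 * g2 q.
  have W0 : W 0 = 0 by rewrite /W expr0n; case: n n2 => [|[|k]]//= _; rewrite mul0r.
  have : W 0 <= W p.
    apply: (is_derive_ge0_le (df := dW)); first exact: ltW.
      move=> q; rewrite in_itv/= => /andP[q0 qp].
      have q1 : `|q| < 1 by apply: abs1; rewrite q0 (le_trans qp pt).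
      have [_ dg1 _] := gP q q1.
      have := is_deriveM (is_derive_exprn n.-1 q) dg1.
      by move=> d; apply: is_derive_eq; rewrite /GRing.scale /= /dW; ring.
    move=> q; rewrite in_itv/= => /andP[q0 qp].
    have q1 : `|q| < 1 by apply: abs1; rewrite ltW//= (le_trans _ pt)// ltW.
    have -> : dW q = q ^+ n.-2 * (q * sphere_avg (laplacian F) q).
      have /mulfI E := lt0r_neq0 q0; have [_ _ O] := gP q q1; rewrite (E _ _ O) /dW.
      case: n n2 => [|[|k]]//= _; rewrite exprS -[k.+2%:R]natr1 addrK; ring.
    by rewrite mulr_ge0// ?exprn_ge0 ?mulr_ge0 ?avg0 ?ltW.
  by rewrite W0 /W pmulr_rge0// exprn_gt0.
apply: (is_derive_ge0_le (df := g1)) => // p; rewrite in_itv/= => /andP[sp pt].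
  by have [] := gP p (abs1 p _); rewrite ?(le_trans s0 sp).
by apply: g10; rewrite (le_lt_trans s0 sp) ltW.
Qed.

(** The comparison principle is used for $h(t)=g(rt)$, whose second derivative gives the factor
    $r^2$, with the kernel rescaled to $k/c$. *)
Lemma sphere_avg_green_le (r c : R) (k E dE : R -> R) : 0 <= r < 1 -> 0 < c ->
  {within `[0, 1], continuous k} -> k 0 = 0 -> k 1 = 0 ->
  (forall t, t \in `]0, 1[ -> is_derive t (1 : R) k ((n%:R - 1) * k t / t - c)) ->
  {within `[0, 1], continuous E} ->
  (forall t, t \in `]0, 1[ -> is_derive t (1 : R) E (dE t)) ->
  (forall t, t \in `]0, 1[ -> k t * (r ^+ 2 * sphere_avg (laplacian F) (r * t)) <= dE t) ->
  sphere_avg F r - F 0 <= (E 1 - E 0) / c.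
Proof.
have [g1 [g2 gP]] := sphere_avg_ode; move: (sphere_avg (laplacian F)) gP => G gP.
move=> /andP[r0 r1] c0 ck k0 k1 dk cE dEt le.
have rt1 t : t \in `[0, 1] -> `|r * t| < 1.
  rewrite in_itv/= => /andP[t0 t1].
  by rewrite ger0_norm ?mulr_ge0// (le_lt_trans _ r1)// ler_piMr.
have cn0 : c != 0 by rewrite gt_eqF.
have dr t : is_derive t (1 : R) (fun t => r * t) r.
  by apply: is_derive_eq; rewrite /GRing.scale /=; ring.
have cM (f : R -> R) : {within `[0, 1], continuous f} -> {within `[0, 1], continuous (fun t : R => f t / c)}.
  move=> cf t; apply: (cvg_comp f (fun y => y / c) (cf t)).
  by apply: cvgM; [exact: cvg_id|exact: cvg_cst].
have dk' t : t \in `]0, 1[ -> is_derive t (1 : R) (fun t => k t / c) ((n%:R - 1) * (k t / c) / t - 1).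
  move=> t01; have d := dk t t01.
  have t0 : t != 0 by move: t01; rewrite in_itv/= => /andP[t0 _]; rewrite gt_eqF.
  by apply: is_derive_eq; rewrite /GRing.scale /=; field; rewrite ?t0 ?cn0.
have dh t : t \in `[0, 1] -> is_derive t (1 : R) (fun t => sphere_avg F (r * t)) (r * g1 (r * t)).
  move=> t01; have [d _ _] := gP _ (rt1 t t01); rewrite mulrC.
  exact: (@is_derive1_comp R (sphere_avg F) (fun t => r * t) t _ _ d (dr t)).
have dh1 t : t \in `[0, 1] -> is_derive t (1 : R) (fun t => r * g1 (r * t)) (r ^+ 2 * g2 (r * t)).
  move=> t01; have [_ d _] := gP _ (rt1 t t01).
  have d2 := @is_derive1_comp R g1 (fun t => r * t) t _ _ d (dr t).
  have := is_deriveZ r d2; rewrite /GRing.scale /= => d'.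
  by rewrite (_ : r ^+ 2 * _ = r * (g2 (r * t) * r)); [exact: d'|ring].
have dE' t : t \in `]0, 1[ -> is_derive t (1 : R) (fun t => E t / c) (dE t / c).
  move=> t01; have d := dEt t t01.
  by apply: is_derive_eq; rewrite /GRing.scale /=; field; rewrite ?cn0.
have le' t : t \in `]0, 1[ ->
    k t / c * (r ^+ 2 * g2 (r * t) + (n%:R - 1) * (r * g1 (r * t)) / t) <= dE t / c.
  move=> t01; rewrite ler_pdivlMr//; apply: le_trans (le t t01).
  have t0 : t != 0 by move: t01; rewrite in_itv/= => /andP[t0 _]; rewrite gt_eqF.
  have [_ _ O] := gP _ (rt1 t (subset_itv_oo_cc t01)).
  (* Only [t] is divided out, so $r=0$ needs no separate treatment. *)
  have -> : r ^+ 2 * G (r * t) = (r * t * (r * t * G (r * t))) / t ^+ 2 by field.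
  by rewrite O; apply/eq_ler; field; rewrite t0 cn0.
have k0' : k 0 / c = 0 by rewrite k0 mul0r.
have k1' : k 1 / c = 0 by rewrite k1 mul0r.
have := radial_comparison (cM _ ck) k0' k1' dk' dh dh1 (cM _ cE) dE' le'.
by rewrite mulr1 mulr0 sphere_avg0 -mulrBl.
Qed.

End green.
End spherical_means.

(** * Spherical mean of the Laplacian of the power of u *)

Section mean_estimates.
Context {R : realType} {n : nat}.
Hypothesis n2 : (2 <= n)%N.
Local Notation S := (@unit_sphere R n).
Local Notation B := (@unit_ball R n).
Implicit Types (f g u : 'rV[R]_n -> R) (s t : R).

Let n_gt0 : (0 < n)%N. Proof. exact: ltnW. Qed.

Let c1 : continuous (fun _ : 'rV[R]_n => 1 : R).
Proof. by move=> z; exact: cst_continuous. Qed.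

Lemma sphere_mean_powR nu f s : nu != 0 ->
  sphere_mean nu f s `^ nu = sphere_avg (fun x => `|f x| `^ nu) s.
Proof.
move=> nu0; rewrite /sphere_mean -powRrM mulVf// powRr1; last first.
  by apply: Rintegral_ge0 => z _; exact: powR_ge0.
by apply: eq_Rintegral => z _; rewrite mul1r.
Qed.

Lemma sphere_avgD f g s : `|s| < 1 -> {in B, continuous f} -> {in B, continuous g} ->
  sphere_avg (fun x => f x + g x) s = sphere_avg f s + sphere_avg g s.
Proof. by move=> s1 cf cg; exact: sphere_intD. Qed.

Lemma sphere_avgZ c f s : `|s| < 1 -> {in B, continuous f} ->
  sphere_avg (fun x => c * f x) s = c * sphere_avg f s.
Proof. by move=> s1 cf; exact: sphere_intZ. Qed.

Lemma continuous_norm_powR_in f p : 0 <= p -> {in B, continuous f} ->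
  {in B, continuous (fun x => `|f x| `^ p)}.
Proof.
move=> p0 cf x Bx; apply: (@continuous_comp _ _ _ f (fun t => `|t| `^ p)); first exact: cf.
exact: continuous_norm_powR.
Qed.

Lemma sphere_avg_holder f g (a b p q nu : R) s : `|s| < 1 ->
  {in B, continuous f} -> {in B, continuous g} ->
  0 <= p -> 0 <= q -> 0 < nu -> p + q <= nu -> 0 < a -> 0 <= b ->
  sphere_avg (fun x => `|f x| `^ nu) s <= a `^ nu ->
  sphere_avg (fun x => `|g x| `^ nu) s <= b `^ nu ->
  sphere_avg (fun x => `|f x| `^ p * `|g x| `^ q) s <= a `^ p * b `^ q.
Proof.
move=> s1 cf cg p0 q0 nu0 pq a0 b0 fa gb.
have mS := @measurable_unit_sphere R n.
have S1 : @sphere_measure R n S = 1%E by exact: sphere_measure_sphere.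
have int h : {in B, continuous h} ->
    (@sphere_measure R n).-integrable S (EFin \o (fun z => h (s *: z))).
  move=> ch; have := integrable_sphere_int n_gt0 c1 ch s1.
  by under eq_fun do rewrite mul1r.
have avgE h : sphere_avg h s = \int[@sphere_measure R n]_(z in S) h (s *: z).
  by apply: eq_Rintegral => z _; rewrite mul1r.
rewrite avgE in fa *; rewrite avgE in gb *; rewrite avgE.
apply: (holder_powR mS S1 (f := fun z => `|f (s *: z)|) (g := fun z => `|g (s *: z)|) (nu := nu)) => //.
- by apply: (int (fun x => `|f x| `^ nu)); apply: continuous_norm_powR_in => //; exact: ltW.
- by apply: (int (fun x => `|g x| `^ nu)); apply: continuous_norm_powR_in => //; exact: ltW.
- apply: (int (fun x => `|f x| `^ p * `|g x| `^ q)) => x Bx.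
  by apply: (@continuousM _ _ (fun x => `|f x| `^ p) (fun x => `|g x| `^ q)); exact: continuous_norm_powR_in.
Qed.

Lemma continuous_enorm_gradient u : C1_in B u -> {in B, continuous (fun x => enorm (gradient u x))}.
Proof.
move=> [_ _ cu] x Bx.
apply: (@continuous_comp _ _ _ (fun x => \sum_i (gradient u x) ord0 i ^+ 2) Num.sqrt); last exact: sqrt_continuous.
apply: continuous_sumr => i _.
apply: (@continuous_comp _ _ _ (fun x => (gradient u x) ord0 i) (fun t => t ^+ 2)); last exact: exprn_continuous.
rewrite (_ : (fun _ => _) = partial i u); first exact: cu.
by apply/funext => y; rewrite mxE.
Qed.

Section laplacian_bound.
Variables (u : 'rV[R]_n -> R) (nu b1 b2 A1 A2 A3 : R).
Hypotheses (cu : C2_in B u) (nu2 : 2 <= nu).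
Hypotheses (hb1 : 0 <= b1 <= 1) (hb2 : 0 <= b2 <= 1).
Hypotheses (A1_ge0 : 0 <= A1) (A2_ge0 : 0 <= A2) (A3_ge0 : 0 <= A3).
Hypothesis lap_le : forall x, B x ->
  `|laplacian u x| <= A1 * enorm (gradient u x) `^ b1 + A2 * `|u x| `^ b2 + A3.
Hypothesis sign : forall x, B x -> 0 <= u x * laplacian u x.

Let nu_gt0 : 0 < nu. Proof. exact: lt_le_trans nu2. Qed.
Let nu2_ge0 : 0 <= nu - 2. Proof. by rewrite subr_ge0. Qed.
Let nu1_gt0 : 0 < nu - 1. Proof. by rewrite subr_gt0 (lt_le_trans _ nu2)// ltr1n. Qed.
Let nu1_ge0 : 0 <= nu - 1. Proof. exact: ltW. Qed.
Let nu1b_gt0 : 0 < nu - 1 + b2. Proof. by case/andP: hb2 => b20 _; rewrite ltr_wpDr. Qed.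

Let F x := `|u x| `^ nu.

Lemma laplacian_norm_powR_ge0 x : B x -> 0 <= laplacian F x.
Proof.
move=> Bx; rewrite (laplacian_norm_powR (@open_eball R n 1) cu nu2 Bx).
have nu0 := ltW nu_gt0.
have ? := powR_ge0 `|u x| (nu - 2).
apply: addr_ge0; first by rewrite !mulr_ge0 ?enorm_ge0 ?nu1_ge0.
by rewrite mulr_ge0// -mulrA mulr_ge0// sign.
Qed.

Let V x := enorm (gradient u x).

(** Every term is brought to the form $|u|^p|V|^q$ with $p+q\le\nu$, zeroth powers included, so that
    a single form of Hoelder's inequality covers all four. *)
Lemma laplacian_norm_powR_le x : B x -> laplacian F x <=
  nu * (nu - 1) * (`|u x| `^ (nu - 2) * `|V x| `^ 2)
  + nu * A1 * (`|u x| `^ (nu - 1) * `|V x| `^ b1)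
  + nu * A2 * (`|u x| `^ (nu - 1 + b2) * `|V x| `^ 0)
  + nu * A3 * (`|u x| `^ (nu - 1) * `|V x| `^ 0).
Proof.
move=> Bx; rewrite (laplacian_norm_powR (@open_eball R n 1) cu nu2 Bx) -/(V x).
have V0 : 0 <= V x by exact: enorm_ge0.
have -> : `|V x| = V x by exact: ger0_norm.
have p1 : `|u x| `^ (nu - 2) * `|u x| = `|u x| `^ (nu - 1).
  have E : nu - 2 + 1 = nu - 1 by ring.
  by rewrite -E [RHS]powRD ?powRr1// E gt_eqF.
have p2 : `|u x| `^ (nu - 1 + b2) = `|u x| `^ (nu - 1) * `|u x| `^ b2.
  by rewrite powRD// gt_eqF.
rewrite powRr0 powR_mulrn// p2 -!addrA lerD2l.
have : u x * laplacian u x <= `|u x| * (A1 * V x `^ b1 + A2 * `|u x| `^ b2 + A3).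
  by rewrite (le_trans (ler_norm _))// normrM ler_wpM2l// lap_le.
move=> /(ler_wpM2l (powR_ge0 `|u x| (nu - 2))) /(ler_wpM2l (ltW nu_gt0)) h.
rewrite -(mulrA (`|u x| `^ (nu - 2))); apply: (le_trans h).
by rewrite (mulrA (`|u x| `^ (nu - 2))) p1; apply/eq_ler; ring.
Qed.

Lemma sphere_avg_laplacian_le s m b : 0 <= s < 1 -> 0 < m -> 0 <= b ->
  sphere_avg F s <= m `^ nu -> sphere_avg (fun x => `|V x| `^ nu) s <= b `^ nu ->
  sphere_avg (laplacian F) s <=
    nu * (nu - 1) * (m `^ (nu - 2) * b ^+ 2) + nu * A1 * (m `^ (nu - 1) * b `^ b1)
    + nu * A2 * m `^ (nu - 1 + b2) + nu * A3 * m `^ (nu - 1).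
Proof.
move=> /andP[s0 s1'] m0 b0 Fm Vb.
have s1 : `|s| < 1 by rewrite ger0_norm.
have cV : {in B, continuous V} by apply: continuous_enorm_gradient; exact: C2_C1.
have cu0 : {in B, continuous u} by case: cu.
have cUV p q : 0 <= p -> 0 <= q -> {in B, continuous (fun x => `|u x| `^ p * `|V x| `^ q)}.
  by move=> p0 q0 x Bx; apply: (@continuousM _ _ (fun x => `|u x| `^ p) (fun x => `|V x| `^ q)); exact: continuous_norm_powR_in.
have ccUV c p q : 0 <= p -> 0 <= q -> {in B, continuous (fun x => c * (`|u x| `^ p * `|V x| `^ q))}.
  move=> p0 q0 x Bx; apply: (@continuousM _ _ (fun=> c) (fun x => `|u x| `^ p * `|V x| `^ q)).
    exact: cst_continuous.
  exact: cUV.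
have cD f g : {in B, continuous f} -> {in B, continuous g} -> {in B, continuous (fun x => f x + g x)}.
  by move=> cf cg x Bx; apply: (@continuousD _ _ _ f g); [exact: cf|exact: cg].
have nu0 := nu_gt0; have n20 := nu2_ge0; have n10 := nu1_ge0.
have [/andP[b10 b11] /andP[b20 b21]] := (hb1, hb2).
have n1b := ltW nu1b_gt0.
have H p q : 0 <= p -> 0 <= q -> p + q <= nu ->
    sphere_avg (fun x => `|u x| `^ p * `|V x| `^ q) s <= m `^ p * b `^ q.
  by move=> p0 q0 pq; exact: (sphere_avg_holder s1 cu0 cV p0 q0 nu0 pq m0 b0 Fm Vb).
pose T1 x := nu * (nu - 1) * (`|u x| `^ (nu - 2) * `|V x| `^ 2).
pose T2 x := nu * A1 * (`|u x| `^ (nu - 1) * `|V x| `^ b1).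
pose T3 x := nu * A2 * (`|u x| `^ (nu - 1 + b2) * `|V x| `^ 0).
pose T4 x := nu * A3 * (`|u x| `^ (nu - 1) * `|V x| `^ 0).
have cT1 : {in B, continuous T1} by apply: ccUV.
have cT2 : {in B, continuous T2} by apply: ccUV.
have cT3 : {in B, continuous T3} by apply: ccUV.
have cT4 : {in B, continuous T4} by apply: ccUV.
have c12 := cD _ _ cT1 cT2; have c123 := cD _ _ c12 cT3; have c1234 := cD _ _ c123 cT4.
have cL := continuous_laplacian (C2_norm_powR (@open_eball R n 1) cu nu2).
apply: (le_trans (ler_sphere_avg n2 s1 cL c1234 laplacian_norm_powR_le)).
rewrite (sphere_avgD s1 c123 cT4) (sphere_avgD s1 c12 cT3) (sphere_avgD s1 cT1 cT2).
rewrite /T1 /T2 /T3 /T4 !sphere_avgZ//; [|exact: cUV..].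
have n1g : 0 <= nu * (nu - 1) by rewrite mulr_ge0// ltW.
have nA A : 0 <= A -> 0 <= nu * A by move=> ?; rewrite mulr_ge0// ltW.
rewrite !lerD//.
- by rewrite ler_wpM2l// -[b ^+ 2]powR_mulrn//; apply: H => //; rewrite subrK.
- by rewrite ler_wpM2l ?nA//; apply: H => //; rewrite -lerBrDl opprB addrCA subrr addr0.
- by rewrite ler_wpM2l ?nA// -[leRHS]mulr1 -[X in _ * X](powRr0 b); apply: H => //; rewrite addr0 -lerBrDl opprB addrCA subrr addr0.
- by rewrite ler_wpM2l ?nA// -[leRHS]mulr1 -[X in _ * X](powRr0 b); apply: H => //; rewrite addr0 lerBlDr lerDl.
Qed.

End laplacian_bound.
End mean_estimates.

(** * The main estimate *)

Section majorant_phi.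
Context {R : realType}.
Variables (alpha beta : R).
Hypotheses (alpha_gt0 : 0 < alpha) (beta_le : beta <= alpha).
Implicit Types (r s t p : R).

Let log_ge1 s : 0 <= s < 1 -> 1 <= 1 - ln (1 - s).
Proof. by move=> /andP[s0 s1]; rewrite lerDl oppr_ge0 ln_le0// gerBl. Qed.

Lemma phi_gt0 s : 0 <= s < 1 -> 0 < phi alpha beta s.
Proof.
move=> s01; have := log_ge1 s01; case/andP: s01 => s0 s1 l1.
by apply: mulr_gt0; apply: powR_gt0; [rewrite subr_gt0|exact: lt_le_trans l1].
Qed.

(** As the logarithmic factor is at least $1$, [beta] may be raised to [alpha]; then $x(1-\ln
    x)\le1$ for $x=1-s$, which is $1+y\le e^y$ at $y=-\ln x$. *)
Lemma phi_le1 s : 0 <= s < 1 -> phi alpha beta s <= 1.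
Proof.
move=> s01; have l1 := log_ge1 s01; case/andP: s01 => s0 s1.
have x0 : 0 < 1 - s by rewrite subr_gt0.
have l0 : 0 <= 1 - ln (1 - s) by rewrite (le_trans ler01).
apply: (@le_trans _ _ ((1 - s) `^ alpha * (1 - ln (1 - s)) `^ alpha)).
  by rewrite ler_wpM2l ?powR_ge0// ler_powR.
have xge0 := ltW x0; have age0 := ltW alpha_gt0.
have one : 1 `^ alpha = 1 :> R by rewrite powR1.
rewrite -powRM// -[leRHS]one; apply: ge0_ler_powR; rewrite ?nnegrE ?mulr_ge0//.
have := @expR_ge1Dx R (- ln (1 - s)); rewrite expRN lnK ?posrE// => h.
by rewrite mulrC -ler_pdivlMr// mul1r.
Qed.

Lemma continuous_phi r t : 0 <= r < 1 -> t \in `[0, 1] ->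
  {for t, continuous (fun t => phi alpha beta (r * t))}.
Proof.
move=> /andP[r0 r1]; rewrite in_itv/= => /andP[t0 t1].
have rt : 0 <= r * t < 1 by rewrite mulr_ge0//= (le_lt_trans _ r1)// ler_piMr.
have l1 := log_ge1 rt.
have x0 : 0 < 1 - r * t by case/andP: rt => _; rewrite subr_gt0.
have c1 : {for t, continuous (fun t => 1 - r * t)}.
  by apply: cvgB; [exact: cvg_cst|exact: mulrl_continuous].
have cp (a y : R) : 0 < y -> {for y, continuous (fun y => y `^ a)}.
  by move=> y0; exact: is_derive_continuous (is_derive1_powR a y0).
apply: (@continuousM _ _ (fun t => (1 - r * t) `^ alpha) (fun t => (1 - ln (1 - r * t)) `^ beta)).
  by apply: (@continuous_comp _ _ _ (fun t => 1 - r * t) (fun y => y `^ alpha)) => //; exact: cp.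
apply: (@continuous_comp _ _ _ (fun t => 1 - ln (1 - r * t)) (fun y => y `^ beta)).
  apply: cvgB; first exact: cvg_cst.
  by apply: (@continuous_comp _ _ _ (fun t => 1 - r * t) (@ln R)) => //; exact: continuous_ln.
by apply: cp; rewrite (lt_le_trans ltr01).
Qed.

Lemma majorant_ge omega p : majorant omega -> 0 < p <= 1 -> p * omega 1 <= omega p.
Proof.
move=> [_ _ _ homo _] /andP[p0 p1].
have := homo 1 p; rewrite !in_itv/= !andbT ltr01 p0 => /(_ isT isT p1).
by rewrite divr1 ler_pdivlMr// mulrC.
Qed.

End majorant_phi.

Section assembly.
Context {R : realType} {n : nat}.
Variables (omega : R -> R) (nu alpha beta b1 b2 : R) (u a1 a2 a3 : 'rV[R]_n -> R).
Hypotheses (hn : (2 <= n)%N) (homega : majorant omega) (hnu : 2 <= nu).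
Hypotheses (halpha : 0 < alpha) (hbeta : beta <= alpha) (hu : C2_in unit_ball u).
Hypotheses (ha1 : forall x, unit_ball x -> 0 <= a1 x)
  (ha2 : forall x, unit_ball x -> 0 <= a2 x) (ha3 : forall x, unit_ball x -> 0 <= a3 x).
Hypotheses (hA1 : bounded_above_ball a1) (hA2 : bounded_above_ball a2)
  (hA3 : bounded_above_ball a3).
Hypotheses (hb1 : 0 <= b1 <= 1) (hb2 : 0 <= b2 <= 1).
Hypothesis hineq : forall x, unit_ball x -> `|laplacian u x| <=
  a1 x * enorm (gradient u x) `^ b1 + a2 x * `|u x| `^ b2 + a3 x.
Hypothesis hsign : forall x, unit_ball x -> 0 <= u x * laplacian u x.
Hypothesis hnorm : bounded_above_ball (weighted_grad omega alpha beta nu u).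

Let B0 : @unit_ball R n 0. Proof. by rewrite /unit_ball /= enorm0. Qed.

Let le_sup_ball (f : 'rV[R]_n -> R) x : bounded_above_ball f -> unit_ball x -> f x <= sup_ball f.
Proof. by move=> bf Bx; apply: ub_le_sup => //; exists x. Qed.

Let A1 := sup_ball a1.
Let A2 := sup_ball a2.
Let A3 := sup_ball a3.
Let M := sphere_mean nu u.
Let N := u_norm omega alpha beta nu u.

Let nu_gt0 : 0 < nu. Proof. exact: lt_le_trans hnu. Qed.
Let omega1_gt0 : 0 < omega 1. Proof. by case: homega. Qed.

Let A_ge0 (f : 'rV[R]_n -> R) : (forall x, unit_ball x -> 0 <= f x) -> bounded_above_ball f -> 0 <= sup_ball f.
Proof. by move=> f0 bf; apply: le_trans (f0 0 B0) _; exact: le_sup_ball. Qed.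

Let lap_le x : unit_ball x -> `|laplacian u x| <=
  A1 * enorm (gradient u x) `^ b1 + A2 * `|u x| `^ b2 + A3.
Proof.
move=> Bx; apply: (le_trans (hineq Bx)).
by rewrite !lerD ?ler_wpM2r ?powR_ge0// le_sup_ball.
Qed.

Let grad_mean_le (s : R) : 0 <= s < 1 ->
  sphere_mean nu (fun y => enorm (gradient u y)) s <= N / (omega 1 * phi alpha beta s).
Proof.
move=> s01; have s01' := s01; case/andP: s01' => s0 s1.
have ph0 := phi_gt0 alpha beta s01; have ph1 := phi_le1 halpha hbeta s01.
have m0 : 0 <= sphere_mean nu (fun y => enorm (gradient u y)) s by exact: powR_ge0.
have n0 : (0 < n)%N by exact: ltnW.
(* The supremum runs over points while the weight depends only on their norm; any point of norm [s]
   serves as a test point. *)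
pose x : 'rV[R]_n := s *: delta_mx ord0 (Ordinal n0).
have xs : enorm x = s.
  rewrite enormZ ger0_norm// /enorm (bigD1 (Ordinal n0))//= big1 ?addr0.
    by rewrite mxE !eqxx expr1n sqrtr1 mulr1.
  by move=> i /negbTE i0; rewrite mxE eqxx i0 expr0n.
have Bx : unit_ball x by rewrite /unit_ball /= xs.
have := le_sup_ball hnorm Bx; rewrite /weighted_grad xs => h.
rewrite (ler_pdivlMr _ _ (mulr_gt0 omega1_gt0 ph0)).
apply: (@le_trans _ _ (sphere_mean nu (fun y => enorm (gradient u y)) s * omega (phi alpha beta s))).
  by rewrite ler_wpM2l// mulrC majorant_ge// ph0.
by rewrite (le_trans h)// lerDr.
Qed.

Let N_ge0 : 0 <= N.
Proof.
have := @grad_mean_le 0; rewrite lexx ltr01 => /(_ isT).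
have ph0 : 0 < phi alpha beta 0 by apply: phi_gt0; rewrite lexx ltr01.
rewrite (ler_pdivlMr _ _ (mulr_gt0 omega1_gt0 ph0)); apply: le_trans.
by apply: mulr_ge0; [exact: powR_ge0|exact/ltW/mulr_gt0].
Qed.

(** The equation imposed on [kappa] says that $(\kappa/t^{n-1})'=-c\,t^{1-n}$: up to scale, [kappa]
    is $t^{n-1}$ times the Green function of the ball with pole at the centre. *)
Variables (kappa : R -> R) (c : R).
Hypothesis c_gt0 : 0 < c.
Hypothesis kappa_cont : {in `[0, 1], continuous kappa}.
Hypotheses (kappa0 : kappa 0 = 0) (kappa1 : kappa 1 = 0).
Hypothesis kappa_ge0 : forall t : R, t \in `]0, 1[ -> 0 <= kappa t.
Hypothesis kappa_derive : forall t : R, t \in `]0, 1[ ->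
  is_derive t (1 : R) kappa ((n%:R - 1) * kappa t / t - c).

Let mu := @lebesgue_measure R.

Lemma sphere_mean_le (r : R) : 0 <= r < 1 -> M r <= Num.sqrt (
  `|u 0| ^+ 2
  + nu * (nu - 1) / (c * omega 1 ^+ 2) * N ^+ 2 * r ^+ 2
    * (\int[mu]_(t in `[0, 1]) (kappa t / phi alpha beta (r * t) ^+ 2))
  + nu * A1 / (c * omega 1 `^ b1) * N `^ b1 * r ^+ 2 * M r
    * (\int[mu]_(t in `[0, 1]) (kappa t / phi alpha beta (r * t) `^ b1))
  + nu * A2 / (2 * n%:R) * r ^+ 2 * M r `^ (1 + b2)
  + nu * A3 / (2 * n%:R) * r ^+ 2 * M r).
Proof.
move=> r01; have /andP[r0 r1] := r01.
have : 0 <= M r by exact: powR_ge0.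
(* If the mean vanishes the bound is trivial. Otherwise [m] is positive, as required by Hoelder's
   inequality and by the final division by $m^{\nu-2}$. *)
rewrite le_eqVlt => /predU1P[<-|]; first exact: sqrtr_ge0.
set m := M r => m0.
pose F x := `|u x| `^ nu.
have cF : C2_in unit_ball F by exact: C2_norm_powR (@open_eball R n 1) hu hnu.
have mE : m `^ nu = sphere_avg F r by apply: sphere_mean_powR; rewrite gt_eqF.
have rt (t : R) : t \in `[0, 1] -> 0 <= r * t < 1.
  by rewrite in_itv/= => /andP[t0 t1]; rewrite mulr_ge0//= (le_lt_trans _ r1)// ler_piMr.
have ph_gt0 (t : R) : t \in `[0, 1] -> 0 < phi alpha beta (r * t) by move=> /rt; exact: phi_gt0.
pose f2 (t : R) := kappa t / phi alpha beta (r * t) ^+ 2.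
pose f1 (t : R) := kappa t / phi alpha beta (r * t) `^ b1.
have cf2 : {in `[0, 1], continuous f2}.
  move=> t t01; apply: (@continuousM _ _ kappa (fun t => (phi alpha beta (r * t) ^+ 2)^-1)).
    exact: kappa_cont.
  apply: continuousV; first by rewrite gt_eqF// exprn_gt0// ph_gt0.
  apply: (@continuous_comp _ _ _ (fun t => phi alpha beta (r * t)) (fun y => y ^+ 2)).
    exact: continuous_phi.
  exact: exprn_continuous.
have cf1 : {in `[0, 1], continuous f1}.
  move=> t t01; apply: (@continuousM _ _ kappa (fun t => (phi alpha beta (r * t) `^ b1)^-1)).
    exact: kappa_cont.
  apply: continuousV; first by rewrite gt_eqF// powR_gt0// ph_gt0.
  apply: (@continuous_comp _ _ _ (fun t => phi alpha beta (r * t)) (fun y => y `^ b1)).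
    exact: continuous_phi.
  exact: is_derive_continuous (is_derive1_powR b1 (ph_gt0 t t01)).
have n_neq0 : n%:R != 0 :> R by rewrite pnatr_eq0 -lt0n ltnW.
have c_neq0 : c != 0 by rewrite gt_eqF.
pose e1 := r ^+ 2 * (nu * (nu - 1) * m `^ (nu - 2) * N ^+ 2 / omega 1 ^+ 2).
pose e2 := r ^+ 2 * (nu * A1 * m `^ (nu - 1) * N `^ b1 / omega 1 `^ b1).
pose e3 := r ^+ 2 * (nu * A2 * m `^ (nu - 1 + b2) + nu * A3 * m `^ (nu - 1)).
(* An explicit primitive of [kappa], found from $(t\kappa)'=n\kappa-ct$. Its value at $1$ is
   $c/(2n)$, and the later division by [c] leaves $1/(2n)$. *)
pose K1 (t : R) := c / (2 * n%:R) * t ^+ 2 + n%:R^-1 * (t * kappa t).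
pose E (t : R) := e1 * primitive f2 t + e2 * primitive f1 t + e3 * K1 t.
pose dE (t : R) := e1 * f2 t + e2 * f1 t + e3 * kappa t.
have cK1 : {within `[0, 1], continuous K1}.
  apply: continuous_in_subspaceT => t /set_mem t01.
  apply: (@continuousD _ _ _ (fun t : R => c / (2 * n%:R) * t ^+ 2) (fun t => n%:R^-1 * (t * kappa t))).
    exact: is_derive_continuous (is_deriveZ (c / (2 * n%:R)) (is_derive_exprn 2 t)).
  apply: (@continuousM _ _ (fun=> n%:R^-1) (fun t : R => t * kappa t)); first exact: cst_continuous.
  by apply: (@continuousM _ _ (fun t : R => t) kappa); [exact: cvg_id|exact: kappa_cont].
have cZ (e : R) (f : R -> R) : {within `[0, 1], continuous f} ->
    {within `[0, 1], continuous (fun t : R => e * f t)}.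
  by move=> cf t; apply: (cvg_comp f (fun y => e * y) (cf t)); exact: mulrl_continuous.
have cE : {within `[0, 1], continuous E}.
  move=> t; apply: cvgD; last exact: (cZ _ _ cK1 t).
  by apply: cvgD; [exact: (cZ _ _ (continuous_primitive cf2) t)|exact: (cZ _ _ (continuous_primitive cf1) t)].
have dEt (t : R) : t \in `]0, 1[ -> is_derive t (1 : R) E (dE t).
  move=> t01; have t0 : t != 0 by move: t01; rewrite in_itv/= => /andP[t0 _]; rewrite gt_eqF.
  have d2 := is_derive_primitive cf2 t01; have d1 := is_derive_primitive cf1 t01.
  have dK1 : is_derive t (1 : R) K1 (kappa t).
    have i1 := is_deriveZ (c / (2 * n%:R)) (is_derive_exprn 2 t).
    have i2 := is_deriveZ (n%:R^-1) (is_deriveM (is_derive_id t (1 : R)) (kappa_derive t01)).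
    apply: (is_derive_eq (is_deriveD i1 i2)).
    by rewrite /GRing.scale /=; field; rewrite t0 n_neq0.
  apply: (is_derive_eq (is_deriveD (is_deriveD (is_deriveZ e1 d2) (is_deriveZ e2 d1)) (is_deriveZ e3 dK1))).
  by [].
have lapF_ge0 x : unit_ball x -> 0 <= laplacian F x.
  by move=> Bx; exact: laplacian_norm_powR_ge0.
have bound (t : R) : t \in `]0, 1[ -> kappa t * (r ^+ 2 * sphere_avg (laplacian F) (r * t)) <= dE t.
  move=> t01; have t01' := subset_itv_oo_cc t01.
  have ph := ph_gt0 t t01'; have rt01 := rt t t01'.
  pose b := N / (omega 1 * phi alpha beta (r * t)).
  have b0 : 0 <= b by rewrite divr_ge0// mulr_ge0// ltW.
  (* Monotonicity of the mean in the radius replaces $M_\nu(u,rt)$ by $M_\nu(u,r)$, which can then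
     leave the integral. *)
  have Fm : sphere_avg F (r * t) <= m `^ nu.
    rewrite mE; apply: sphere_avg_nondecreasing => //.
    case/andP: rt01 => -> _ /=; move: t01'; rewrite in_itv/= => /andP[t0 t1].
    by rewrite ler_piMr.
  have Vb : sphere_avg (fun x => `|enorm (gradient u x)| `^ nu) (r * t) <= b `^ nu.
    rewrite -sphere_mean_powR ?gt_eqF// ge0_ler_powR ?nnegrE ?powR_ge0 ?(ltW nu_gt0)//.
    exact: grad_mean_le.
  have := sphere_avg_laplacian_le hn hu hnu hb1 hb2 (A_ge0 ha1 hA1) (A_ge0 ha2 hA2) (A_ge0 ha3 hA3)
    lap_le rt01 m0 b0 Fm Vb.
  move=> h; rewrite mulrA [kappa t * _]mulrC.
  have kr : 0 <= r ^+ 2 * kappa t by rewrite mulr_ge0 ?sqr_ge0 ?kappa_ge0.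
  apply: (le_trans (ler_wpM2l kr h)).
  have bb : b `^ b1 = N `^ b1 / (omega 1 `^ b1 * phi alpha beta (r * t) `^ b1).
    have w0 := ltW omega1_gt0; have ph' := ltW ph.
    have wp0 := mulr_ge0 w0 ph'.
    by rewrite /b powRM ?invr_ge0// powRV// powRM.
  rewrite bb /dE /e1 /e2 /e3 /f1 /f2 /b; apply/eq_ler.
  have w1 : omega 1 != 0 by rewrite gt_eqF.
  have w2 : omega 1 `^ b1 != 0 by rewrite gt_eqF ?powR_gt0.
  have w3 : phi alpha beta (r * t) != 0 by rewrite gt_eqF.
  have w4 : phi alpha beta (r * t) `^ b1 != 0 by rewrite gt_eqF ?powR_gt0.
  move: (phi alpha beta (r * t)) w3 w4 => p w3 w4.
  by rewrite -/A1 -/A2 -/A3; field; rewrite w1 w2 w3 w4.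
have kw : {within `[0, 1], continuous kappa}.
  by apply: continuous_in_subspaceT => t /set_mem; exact: kappa_cont.
have key := sphere_avg_green_le hn cF r01 c_gt0 kw kappa0 kappa1 kappa_derive cE dEt bound.
have u0m : `|u 0| <= m.
  have : sphere_avg F 0 <= sphere_avg F r by apply: sphere_avg_nondecreasing; rewrite ?lexx.
  rewrite (sphere_avg0 hn) -mE => h.
  by rewrite leNgt; apply/negP => mu0; move: h; rewrite leNgt (gt0_ltr_powR nu_gt0) ?nnegrE// ltW.
have E0 : E 0 = 0 by rewrite /E !primitive0 /K1 expr0n /= !(mulr0, mul0r, addr0).
rewrite E0 subr0 -mE /E /K1 expr1n kappa1 !mulr1 !mulr0 addr0 in key.
have I2E : \int[mu]_(t in `[0, 1]) (kappa t / phi alpha beta (r * t) ^+ 2) = primitive f2 1 by [].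
have I1E : \int[mu]_(t in `[0, 1]) (kappa t / phi alpha beta (r * t) `^ b1) = primitive f1 1 by [].
rewrite I2E I1E.
set I2 := primitive f2 1 in key *; set I1 := primitive f1 1 in key *.
have m_neq0 : m != 0 by rewrite gt_eqF.
(* The factor common to all terms: after multiplication by [p] the squared estimate has $m^\nu$, the
   mean of [F], on its left. *)
set p := m `^ (nu - 2).
have p0 : 0 < p by rewrite powR_gt0.
have q1 : m `^ (nu - 1) = p * m.
  have -> : nu - 1 = (nu - 2) + 1 by ring.
  by rewrite powRD ?m_neq0 ?implybT// powRr1// ltW.
have q2 : m `^ (nu - 1 + b2) = p * m `^ (1 + b2).
  have -> : nu - 1 + b2 = (nu - 2) + (1 + b2) by ring.
  by rewrite powRD ?m_neq0 ?implybT.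
have q0 : m `^ nu = p * m ^+ 2.
  have -> : nu = (nu - 2) + 2 by ring.
  by rewrite powRD ?m_neq0 ?implybT// powR_mulrn ?(ltW m0)// /p; congr (_ `^ _ * _); ring.
(* Only $\nu-2$ of the $\nu$ factors $|u(0)|$ are bounded by [m], so that exactly $|u(0)|^2$
   survives the division by [p]. *)
have qF : F 0 <= p * `|u 0| ^+ 2.
  have nu2 : nu - 2 + 2 = nu by ring.
  rewrite /F -[X in _ `^ X]nu2 powRD; last by rewrite nu2 gt_eqF.
  rewrite powR_mulrn// ler_wpM2r ?sqr_ge0// ge0_ler_powR ?nnegrE ?(ltW m0)//.
  by rewrite subr_ge0.
rewrite -[leLHS](ger0_norm (ltW m0)) -sqrtr_sqr; apply: ler_wsqrtr.
rewrite -(ler_pM2l p0) -q0.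
rewrite lerBlDr in key; apply: (le_trans key); rewrite addrC.
apply: (le_trans (lerD qF (lexx _))); apply/eq_ler.
rewrite /e1 /e2 /e3 -/p q1 q2.
have w1 : omega 1 != 0 by rewrite gt_eqF.
have w2 : omega 1 `^ b1 != 0 by rewrite gt_eqF ?powR_gt0.
by field; rewrite w1 w2 c_neq0 n_neq0.
Qed.

End assembly.

(** * Green kernels: powers for n at least 3, logarithm for n = 2 *)

Section kernels.
Context {R : realType}.
Implicit Type t : R.

Lemma is_derive_power_kernel (m : nat) t :
  is_derive t (1 : R) (fun t => t * (1 - t ^+ m)) (1 - m.+1%:R * t ^+ m).
Proof.
have d1 := is_deriveB (is_derive_cst (1 : R) t (1 : R)) (is_derive_exprn m t).
apply: (is_derive_eq (is_deriveM (is_derive_id t (1 : R)) d1)).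
rewrite /GRing.scale /= -[(cst 1 - _) t]/(1 - t ^+ m).
case: m {d1} => [|m] /=; first by rewrite expr0; ring.
by rewrite -[m.+2%:R]natr1 !exprS; ring.
Qed.

Lemma is_derive_log_kernel t : 0 < t ->
  is_derive t (1 : R) (fun t => t * ln (1 / t)) (t * ln (1 / t) / t - 1).
Proof.
move=> t0; have tn0 : t != 0 by rewrite gt_eqF.
have d := is_deriveM (is_derive_id t (1 : R)) (is_deriveN (is_derive1_ln t0)).
have : is_derive t (1 : R) (fun t => t * - ln t) (- ln t - 1).
  by apply: (is_derive_eq d); rewrite /GRing.scale /= -[(- _) t]/(- ln t); field.
rewrite mul1r lnV ?posrE// (_ : t * - ln t / t = - ln t); last by field.
apply: near_eq_is_derive; near=> x.
have x0 : 0 < x by near: x; exact: lt_nbhsr.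
by rewrite mul1r lnV ?posrE.
Unshelve. all: by end_near. Qed.

(** At the origin the kernel is squeezed by $2\sqrt{|x|}$, obtained from $\ln y^{-1}\le y^{-1}$ with
    $y=\sqrt x$. Continuity is two-sided, and to the left of $0$ the convention that [ln] vanishes
    on nonpositive reals makes the kernel zero. *)
Lemma continuous_log_kernel t : 0 <= t -> {for t, continuous (fun t => t * ln (1 / t))}.
Proof.
rewrite le_eqVlt => /predU1P[<-|t0]; last exact: is_derive_continuous (is_derive_log_kernel t0).
rewrite /prop_for /continuous_at /= mul0r.
have c2 : 2 * Num.sqrt `|x| @[x --> (0 : R)] --> 2 * Num.sqrt `|0 : R|.
  apply: cvgM; first exact: cvg_cst.
  apply: (cvg_comp (fun x : R => `|x|) Num.sqrt (@norm_continuous R R 0)).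
  exact: sqrt_continuous.
rewrite normr0 sqrtr0 mulr0 in c2.
apply/(@norm_cvg0P _ _ _ (nbhs (0 : R)) (nbhs_filter (0 : R))).
apply: (squeeze_cvgr _ (cvg_cst (0 : R)) c2); near=> x.
rewrite normr_ge0 /=.
have [x0|x0|->] := ltgtP x 0; last by rewrite mul0r normr0 sqrtr0 mulr0.
- by rewrite ln0 ?mulr0 ?normr0 ?mulr_ge0 ?sqrtr_ge0// mul1r invr_le0 ltW.
- have x1 : x <= 1 by apply/ltW; near: x; apply: lt_nbhsl; exact: ltr01.
  pose y := Num.sqrt x; have y0 : 0 < y by rewrite sqrtr_gt0.
  have xE : x = y ^+ 2 by rewrite sqr_sqrtr// ltW.
  have l : ln y^-1 <= y^-1.
    have := @expR_ge1Dx R (ln y^-1); rewrite lnK ?posrE ?invr_gt0//.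
    by apply: le_trans; rewrite lerDr.
  have l0 : 0 <= ln x^-1 by rewrite ln_ge0// invf_ge1.
  rewrite mul1r ger0_norm; last by rewrite mulr_ge0// ltW.
  rewrite (gtr0_norm x0) -/y {1 2}xE -exprVn lnXn ?invr_gt0// mulr2n.
  apply: (@le_trans _ _ (y ^+ 2 * (y^-1 + y^-1))).
    by rewrite ler_wpM2l ?sqr_ge0// lerD.
  by apply/eq_ler; field; rewrite gt_eqF.
Unshelve. all: by end_near. Qed.

End kernels.

Unset Implicit Arguments.
Set Strict Implicit.
Set Printing Implicit Defensive.

Theorem theorem4 (R : realType) (n : nat) (omega : R -> R)
  (nu alpha beta b1 b2 : R) (u a1 a2 a3 : 'rV[R]_n -> R)
  (hn : (2 <= n)%N) (homega : majorant omega) (hnu : 2 <= nu)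
  (halpha : 0 < alpha) (hbeta : beta <= alpha)
  (hu : C2_in unit_ball u)
  (ha1 : {in unit_ball, continuous a1}) (ha1_ge0 : forall x, unit_ball x -> 0 <= a1 x)
  (ha2 : {in unit_ball, continuous a2}) (ha2_ge0 : forall x, unit_ball x -> 0 <= a2 x)
  (ha3 : {in unit_ball, continuous a3}) (ha3_ge0 : forall x, unit_ball x -> 0 <= a3 x)
  (hA1 : bounded_above_ball a1)
  (hA2 : bounded_above_ball a2) (hA2_lt : sup_ball a2 < 2 * n%:R / nu)
  (hA3 : bounded_above_ball a3)
  (hb1 : 0 <= b1 <= 1) (hb2 : 0 <= b2 <= 1)
  (hineq : forall x, unit_ball x ->
     `|laplacian u x| <=
       a1 x * enorm (gradient u x) `^ b1 + a2 x * `|u x| `^ b2 + a3 x)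
  (hsign : forall x, unit_ball x -> 0 <= u x * laplacian u x)
  (hnorm : bounded_above_ball (weighted_grad omega alpha beta nu u)) :
  let A1 := sup_ball a1 in
  let A2 := sup_ball a2 in
  let A3 := sup_ball a3 in
  let M := sphere_mean nu u in
  let N := u_norm omega alpha beta nu u in
  ((3 <= n)%N -> forall r : R, 0 <= r < 1 ->
    M r <= Num.sqrt (
      `|u 0| ^+ 2
      + nu * (nu - 1) / ((n%:R - 2) * omega 1 ^+ 2) * N ^+ 2 * r ^+ 2
        * (\int[lebesgue_measure]_(t in `[0, 1])
             (t * (1 - t ^+ (n - 2)) / phi alpha beta (r * t) ^+ 2))
      + nu * A1 / ((n%:R - 2) * omega 1 `^ b1) * N `^ b1 * r ^+ 2 * M r
        * (\int[lebesgue_measure]_(t in `[0, 1])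
             (t * (1 - t ^+ (n - 2)) / phi alpha beta (r * t) `^ b1))
      + nu * A2 / (2 * n%:R) * r ^+ 2 * M r `^ (1 + b2)
      + nu * A3 / (2 * n%:R) * r ^+ 2 * M r)) /\
  (n = 2%N -> forall r : R, 0 <= r < 1 ->
    M r <= Num.sqrt (
      `|u 0| ^+ 2
      + nu * (nu - 1) / omega 1 ^+ 2 * N ^+ 2 * r ^+ 2
        * (\int[lebesgue_measure]_(t in `[0, 1])
             (t * ln (1 / t) / phi alpha beta (r * t) ^+ 2))
      + nu * A1 / omega 1 `^ b1 * N `^ b1 * r ^+ 2 * M r
        * (\int[lebesgue_measure]_(t in `[0, 1])
             (t * ln (1 / t) / phi alpha beta (r * t) `^ b1))
      + nu * A2 / 4 * r ^+ 2 * M r `^ (1 + b2)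
      + nu * A3 / 4 * r ^+ 2 * M r)).
Proof.
split=> [n3|n2] r r01.
- have c0 : 0 < n%:R - 2 :> R by rewrite subr_gt0 ltr_nat.
  (* The subtraction on the left is truncated; $n\ge3$ makes it a true one, so that the exponent
     $n-2$ produces the coefficient $n-1$. *)
  have nE : (n - 2).+1%:R = n%:R - 1 :> R by rewrite -natr1 natrB//; ring.
  have kd (t : R) : is_derive t (1 : R) (fun t => t * (1 - t ^+ (n - 2))) (1 - (n%:R - 1) * t ^+ (n - 2)).
    by rewrite -nE; exact: is_derive_power_kernel.
  pose kappa (t : R) := t * (1 - t ^+ (n - 2)).
  have kc : {in `[0, 1], continuous kappa}.
    by move=> t _; exact: is_derive_continuous (kd t).
  have k0 : kappa 0 = 0 by rewrite /kappa mul0r.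
  have k1 : kappa 1 = 0 by rewrite /kappa expr1n subrr mulr0.
  have kge0 (t : R) : t \in `]0, 1[ -> 0 <= kappa t.
    rewrite in_itv/= => /andP[t0 t1].
    by rewrite mulr_ge0 ?subr_ge0 ?exprn_ile1// ltW.
  have kd' (t : R) : t \in `]0, 1[ ->
      is_derive t (1 : R) kappa ((n%:R - 1) * kappa t / t - (n%:R - 2)).
    rewrite in_itv/= => /andP[t0 t1].
    by apply: (is_derive_eq (kd t)); rewrite /kappa; field; rewrite gt_eqF.
  exact: (sphere_mean_le hn homega hnu halpha hbeta hu ha1_ge0 ha2_ge0 ha3_ge0 hA1 hA2 hA3 hb1 hb2
    hineq hsign hnorm c0 kc k0 k1 kge0 kd' r01).
- have kd (t : R) : t \in `]0, 1[ -> is_derive t (1 : R) (fun t => t * ln (1 / t))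
      ((n%:R - 1) * (t * ln (1 / t)) / t - 1).
    rewrite in_itv/= => /andP[t0 t1]; rewrite n2 (_ : 2 - 1 = 1 :> R); last by ring.
    by rewrite (mul1r (t * ln (1 / t))); exact: is_derive_log_kernel.
  pose kappa (t : R) := t * ln (1 / t).
  have kc : {in `[0, 1], continuous kappa}.
    by move=> t; rewrite in_itv/= => /andP[t0 _]; exact: continuous_log_kernel.
  have k0 : kappa 0 = 0 by rewrite /kappa mul0r.
  have k1 : kappa 1 = 0 by rewrite /kappa divr1 ln1 mulr0.
  have kge0 (t : R) : t \in `]0, 1[ -> 0 <= kappa t.
    rewrite in_itv/= => /andP[t0 t1]; rewrite /kappa mul1r.
    by rewrite mulr_ge0 ?(ltW t0)// ln_ge0// invf_ge1// ltW.
  have := sphere_mean_le hn homega hnu halpha hbeta hu ha1_ge0 ha2_ge0 ha3_ge0 hA1 hA2 hA3 hb1 hb2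
    hineq hsign hnorm ltr01 kc k0 k1 kge0 kd r01.
  have n4 : 2 * n%:R = 4 :> R by rewrite n2; ring.
  by rewrite n4 (mul1r (omega 1 ^+ 2)) (mul1r (omega 1 `^ b1)).
Qed.
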